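(* Let $S$ be a nonempty, closed and convex subset of a Banach algebra $E$ satisfying condition $(\mathcal{P})$. Assume that $A, C : E \to \mathcal{P}_{cl,cv}(E)$ and $B : S \to \mathcal{P}(E)$ are three multi-valued mappings with weakly sequentially closed graphs such that: (i) $A$ is $\mathcal{D}$-set-Lipschitzian with $\mathcal{D}$-function $\Phi$; (ii) $B$ is a countably $\alpha$-set-contraction; (iii) $C$ is a $\gamma$-set-contraction; (iv) $A(E)$, $B(S)$ and $C(E)$ are bounded; (v) for each $u\in S$, $\left(\frac{I-C}{A}\right)^{-1}B(u)$ is a closed, convex subset of $S$. Then the operator inclusion $x\in A(x)\cdot B(x)+C(x)$ has a solution in $S$ whenever there exists a positive constant $\delta$ with $\alpha<\delta<\frac{1-\gamma}{\|A(S)\|}$ such that $\|B(S)\|\Phi(r)<(1-2\delta\|A(S)\|-\gamma)\,r$ for all $r>0$.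
   Context: $\mathcal{P}(E)$ (resp. $\mathcal{P}_{cl,cv}(E)$) is the family of all nonempty (resp. nonempty closed convex) subsets of $E$. For a multi-valued $F$ and a subset $M$ of its domain, $F(M)=\bigcup_{x\in M}F(x)$. For $M\subset E$, $\|M\|=\sup\{\|x\|:x\in M\}$. Products and sums of sets are taken elementwise. $\rightharpoonup$ denotes weak convergence. Condition $(\mathcal P)$ for a Banach algebra $E$: whenever $\alpha_n\rightharpoonup\alpha$ and $\beta_n\rightharpoonup\beta$ in $E$, then $\alpha_n\cdot\beta_n\rightharpoonup\alpha\cdot\beta$. Write $y\in\left(\frac{I-C}{A}\right)(x)$ if $x\in A(x)\cdot y+C(x)$. For $M\subset E$, $\left(\frac{I-C}{A}\right)^{-1}(M)=\{x\in E: \left(\frac{I-C}{A}\right)(x)\cap M\ne\emptyset\}$, so $\left(\frac{I-C}{A}\right)^{-1}B(u)=\{x\in E:\ \exists y\in B(u),\ x\in A(x)\cdot y+C(x)\}$. For $F:D\to\mathcal P(E)$, $D\subset E$: $F$ has a weakly sequentially closed graph if whenever $x_n\in D$, $x_n\rightharpoonup x\in D$, $y_n\in F(x_n)$ and $y_n\rightharpoonup y$ in $E$, then $y\in F(x)$. $\beta$ is the De Blasi measure of weak noncompactness: for bounded $W\subset E$, $\beta(W)=\inf\{\varepsilon>0:\ \exists K\subset E \text{ weakly compact},\ W\subset K+\mathcal{B}_E(\varepsilon)\}$, where $\mathcal{B}_E(\varepsilon)$ is the closed ball of radius $\varepsilon$ centred at the origin. $F$ is $\mathcal{D}$-set-Lipschitzian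 with $\mathcal D$-function $\Phi$ if $\Phi:\mathbb{R}_+\to\mathbb{R}_+$ is continuous, nondecreasing, $\Phi(0)=0$, and $\beta(F(W))\le\Phi(\beta(W))$ for every bounded subset $W$ of $D$ with $F(W)$ bounded. $F$ is a $k$-set-contraction (resp. countably $k$-set-contraction), $0\le k<1$, if $\beta(F(W))\le k\,\beta(W)$ for every bounded (resp. countable bounded) subset $W$ of $D$ with $F(W)$ bounded. *)

(* Defs.v *)
From HB Require Import structures.
From mathcomp Require Import all_boot all_order all_algebra.
From mathcomp Require Import all_classical all_reals all_analysis.

Set Implicit Arguments.
Unset Strict Implicit.
Unset Printing Implicit Defensive.

Import Order.TTheory GRing.Theory Num.Theory.
Import numFieldNormedType.Exports.

Local Open Scope classical_set_scope.
Local Open Scope ring_scope.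

(* Real Banach algebras: neither a unit nor commutativity is required, which
   is why the product is not taken from MathComp's ring structures.  A complex
   Banach algebra is covered by restriction of scalars, since the real parts of
   the continuous complex functionals are exactly the continuous real ones. *)
HB.mixin Record CompleteNormedModule_isBanachAlgebra (R : realType) E
    of CompleteNormedModule R E := {
  bmul : E -> E -> E ;
  bmulA : associative bmul ;
  bmulDl : left_distributive bmul +%R ;
  bmulDr : right_distributive bmul +%R ;
  bmulZl : forall (a : R) (x y : E), bmul (a *: x) y = a *: bmul x y ;
  bmulZr : forall (a : R) (x y : E), bmul x (a *: y) = a *: bmul x y ;
  ler_norm_bmul : forall x y : E, `|bmul x y| <= `|x| * `|y|
}.

#[short(type="banachAlgType")]
HB.structure Definition BanachAlgebra (R : realType) :=
  {E of CompleteNormedModule R E & CompleteNormedModule_isBanachAlgebra R E}.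

Section WeakTopology.
Context {R : realType}.
Implicit Type E : completeNormedModType R.

Definition dual E : Type := {f : {linear E -> R^o} | continuous f}.

(* The coarsest topology on E making every element of the dual continuous. *)
Definition weak E : Type :=
  sup_topology (fun f : dual E =>
    Topological.class (initial_topology (sval f : E -> R^o))).

HB.instance Definition _ E := Topological.on (weak E).

Definition weak_cvg E (u : nat -> E) (x : E) : Prop :=
  (u : nat -> weak E) @ \oo --> (x : weak E).

Lemma weak_cvgP E (u : nat -> E) (x : E) :
  weak_cvg u x <-> forall f : {linear E -> R^o}, continuous f ->
    f (u n) @[n --> \oo] --> f x.
Proof.
rewrite /weak_cvg cvg_sup; split=> [H f cf|H [f cf]].
  exact: continuous_cvg (@initial_continuous E R^o f x)
    (H (exist _ f cf : dual E)).
move=> V [_ [[B oB <-] Bx sBV]].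
by apply: filterS sBV _; apply: (H f cf); exact: open_nbhs_nbhs.
Qed.

Definition weakly_compact E (K : set E) : Prop := compact (K : set (weak E)).

End WeakTopology.

Section SetValued.
Context {R : realType} {E : banachAlgType R}.
Implicit Types (W D M N : set E) (F : E -> set E) (Phi : R -> R) (k : R).

Definition condition_P : Prop :=
  forall (a b : nat -> E) (x y : E), weak_cvg a x -> weak_cvg b y ->
    weak_cvg (fun n => bmul (a n) (b n)) (bmul x y).

Definition sum_set M N : set E := [set x + y | x in M & y in N].

Definition prod_set M N : set E := [set bmul x y | x in M & y in N].

(* A real supremum, to be used on nonempty bounded sets only. *)
Definition norm_set M : R := sup [set `|x| | x in M].

Definition cball (e : R) : set E := [set z | `|z| <= e].

(* The De Blasi measure of weak noncompactness of a bounded set W. *)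
Definition de_blasi W : R :=
  inf [set e | 0 < e /\
    exists K : set E, weakly_compact K /\ W `<=` sum_set K (cball e)].

(* A multi-valued map with domain D is a total F : E -> set E of which only
   the restriction to D is ever used. *)
Definition multimap D F : Prop := forall x, D x -> F x !=set0.

Definition closed_convex_valued D F : Prop :=
  forall x, D x -> closed (F x) /\ convex_set (F x).

Definition mimage F M : set E := \bigcup_(x in M) F x.

Definition weakly_seq_closed_graph D F : Prop :=
  forall (x_ y_ : nat -> E) (x y : E),
    (forall n, D (x_ n)) -> D x -> weak_cvg x_ x ->
    (forall n, F (x_ n) (y_ n)) -> weak_cvg y_ y -> F x y.

Definition D_function Phi : Prop :=
  [/\ forall r, 0 <= r -> 0 <= Phi r,
      {within `[0, +oo[, continuous Phi},
      {in `[0, +oo[ &, {homo Phi : r s / r <= s}} &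
      Phi 0 = 0].

Definition D_set_lipschitzian D F Phi : Prop :=
  D_function Phi /\
  forall W, W `<=` D -> bounded_set W -> bounded_set (mimage F W) ->
    de_blasi (mimage F W) <= Phi (de_blasi W).

Definition set_contraction D F k : Prop :=
  0 <= k < 1 /\
  forall W, W `<=` D -> bounded_set W -> bounded_set (mimage F W) ->
    de_blasi (mimage F W) <= k * de_blasi W.

Definition countably_set_contraction D F k : Prop :=
  0 <= k < 1 /\
  forall W, W `<=` D -> countable W -> bounded_set W ->
    bounded_set (mimage F W) ->
    de_blasi (mimage F W) <= k * de_blasi W.

(* The multi-valued operator (I - C) / A. *)
Definition quot_IC (A C : E -> set E) (x : E) : set E :=
  [set y | sum_set (prod_set (A x) [set y]) (C x) x].

Definition minverse F M : set E := [set x | F x `&` M !=set0].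

End SetValued.

Arguments condition_P {R} E.

(* Main.v *)
(** Let H(u) be the set of the x with x in A(x).y + C(x) for some y in B(u); a
    fixed point of H solves the inclusion.  H has nonempty values by the same
    fixed point theorem that is then applied to H itself: a convex-valued map
    which has a weakly sequentially closed graph, has a bounded range and
    decreases the De Blasi measure of sequences has a fixed point.

    To prove that theorem, fix a selection h and let V be the countable set
    generated from one point by h and by finite averages.  Up to that point V
    consists of averages of h(V), and averages do not increase the De Blasi
    measure (Krein-Smulian), so V is relatively weakly compact.  Scarf's
    combinatorial lemma gives, for any finite set of functionals, a point of V
    which is approximately an average of values h(z) at points z of V near it; a
    weak limit of such points is a fixed point by Hahn-Banach separation.

    Weak compactness is handled through ultrafilters on nat, and a functional is
    a plain function E -> R with an explicit Lipschitz constant. *)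

Require Import Defs.
From HB Require Import structures.
From mathcomp Require Import all_boot all_order all_algebra.
From mathcomp Require Import zify ring lra.

Set Implicit Arguments.
Unset Strict Implicit.
Unset Printing Implicit Defensive.

(** * Scarf's lemma *)

(** A selection [h] need not be continuous, so a topological fixed point theorem cannot be applied
    to it. Scarf's lemma only asks for a colouring of grid points, and here a grid point is coloured
    by the weak cell of the average it encodes. Grid points have rational coordinates, so averages
    with equal weights suffice and V stays countable, as the hypothesis on B demands. V is
    relatively weakly compact because its measure is at most that of h(V), while condensation would
    make it strictly larger unless it vanishes.

    Compactness is obtained along ultrafilters, whereas the graphs and condition (P) only speak of
    sequences. Returning to sequences, for countably many of them at once, is the main topological
    obstacle.

    The inner fixed point, with y in B(u) frozen, is sought in the whole of E, because A(x).y + C(x)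
    may leave S; hypothesis (v) then places it in S. For the outer one, the measure of a product is
    at most beta(a)|b| + 2|a|beta(b). Together with alpha < delta this is the origin of the term 2
    delta |A(S)| in the growth condition. *)

Section Scarf.
Variables (X I : finType) (r : I -> X -> nat) (c : X -> I).
Hypothesis rI : forall i, injective (r i).
Implicit Types (D : {set X}) (C : {set I}) (p q : {set X} * {set I}).

(** No [x] exceeds the minimum over [p.1] in all the orders [r i], [i] in [p.2], at once. *)
Definition dominant p : bool :=
  [forall x, exists i in p.2, forall d in p.1, r i x <= r i d].

Lemma dominantP D C :
  reflect (forall x, exists2 i, i \in C & forall d, d \in D -> r i x <= r i d)
          (dominant (D, C)).
Proof.
apply: (iffP forallP) => H x.
  by have /existsP[i /andP[iC /forall_inP Hi]] := H x; exists i.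
by have [i iC Hi] := H x; apply/existsP; exists i; rewrite iC; apply/forall_inP.
Qed.

Definition argminD d0 D i : X := [arg min_(d < d0 in D) r i d].

Lemma argminD_in d0 D i : d0 \in D -> argminD d0 D i \in D.
Proof. by move=> d0D; rewrite /argminD; case: arg_minnP. Qed.

Lemma argminD_le d0 D i d : d0 \in D -> d \in D -> r i (argminD d0 D i) <= r i d.
Proof. by move=> d0D; rewrite /argminD; case: arg_minnP => // x _ H /H. Qed.

Lemma argminD_eq d0 D i d : d0 \in D -> d \in D ->
  (forall d', d' \in D -> r i d <= r i d') -> argminD d0 D i = d.
Proof.
move=> d0D dD H; apply: (rI (i := i)); apply/eqP; rewrite eqn_leq argminD_le //=.
by rewrite H // argminD_in.
Qed.

(** Applied to an element of [D], dominance returns an order in which that element is the smallest.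
    Hence [D] has at most as many elements as [C]. *)
Lemma dominant_argmin d0 D C : d0 \in D -> dominant (D, C) ->
  argminD d0 D @: C = D.
Proof.
move=> d0D /dominantP H; apply/setP => x; apply/imsetP/idP => [[i iC ->]|xD].
  exact: argminD_in.
by have [i iC Hi] := H x; exists i => //; rewrite (argminD_eq d0D xD Hi).
Qed.

(** From a door to a room: either one more element or one order fewer. Both moves lower the surplus
    of orders over elements from one to zero. *)
Definition incident q p : bool :=
  [exists x, (x \notin q.1) && (p == (x |: q.1, q.2))]
  || [exists i in q.2, p == (q.1, q.2 :\ i)].

Lemma incidentP D C p :
  reflect ((exists2 x, x \notin D & p = (x |: D, C)) \/
           (exists2 i, i \in C & p = (D, C :\ i)))
          (incident (D, C) p).
Proof.
apply: (iffP orP) => -[].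
- by move=> /existsP[x /andP[xD /eqP ->]]; left; exists x.
- by move=> /existsP[x /andP[xD /eqP ->]]; right; exists x.
- by move=> [x xD ->]; left; apply/existsP; exists x; rewrite xD eqxx.
- by move=> [x xD ->]; right; apply/existsP; exists x; rewrite xD eqxx.
Qed.

Definition rooms : {set {set X} * {set I}} :=
  [set p | dominant p & #|p.1| == #|p.2|].

(** A surjection onto a set with one element fewer must identify two indices. The last clause says
    that deleting an index can restore injectivity only if it is one of these two. *)
Lemma collision (D : {set X}) (C : {set I}) (f : I -> X) :
  f @: C = D -> #|C| = #|D|.+1 ->
  exists i j, [/\ i \in C, j \in C, i != j, f i = f j &
    (forall k, k \in C -> {in C :\ k &, injective f} -> k = i \/ k = j)].
Proof.
move=> fC cC.
have : ~~ [forall k in C, forall l in C, (f k == f l) ==> (k == l)].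
  apply/negP => /forall_inP H.
  have : #|f @: C| = #|C|.
    apply/card_in_imset => k l kC lC /eqP fkl; apply/eqP.
    by have /forall_inP /(_ l lC) /implyP := H k kC; apply.
  by rewrite fC cC => /eqP; rewrite ltn_eqF.
rewrite negb_forall => /existsP[i]; rewrite negb_imply => /andP[iC].
rewrite negb_forall => /existsP[j]; rewrite !negb_imply => /and3P[jC /eqP fij ij].
exists i, j; split => // k kC kI.
have [->|ki] := eqVneq k i; first by left.
have [->|kj] := eqVneq k j; first by right.
by case/eqP: ij; apply: kI => //; rewrite !inE eq_sym ?ki ?kj ?iC ?jC.
Qed.

(** * The two rooms of a door *)

Section Door.
Variables (D : {set X}) (C : {set I}) (d0 : X).
Hypotheses (d0D : d0 \in D) (domDC : dominant (D, C)) (cDC : #|C| = #|D|.+1).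
Let mu := argminD d0 D.
(** These are the points that would break dominance if the order [k] were dropped. If there are
    none, [room k] drops [k]; otherwise it adds the one ranked highest by [k], and then [k] itself
    takes care of all the points of [M k]. *)
Let M (k : I) : {set X} := [set x | [forall l in C, (l != k) ==> (r l (mu l) < r l x)]].
Let room (k : I) := if [pick x in M k] is Some x0
  then ([arg max_(x > x0 in M k) r k x] |: D, C) else (D, C :\ k).

Let MP k x : reflect (forall l, l \in C -> l != k -> r l (mu l) < r l x) (x \in M k).
Proof.
rewrite inE; apply: (iffP forall_inP) => H l lC.
  by move=> lk; have /implyP := H l lC; apply.
by apply/implyP => lk; exact: H.
Qed.

Let nMP k x : x \notin M k -> exists l, [/\ l \in C, l != k & r l x <= r l (mu l)].
Proof.
rewrite inE negb_forall => /existsP[l]; rewrite !negb_imply -leqNgt => /and3P[*].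
by exists l.
Qed.

Let M_le k x : x \in M k -> k \in C /\ forall d, d \in D -> r k x <= r k d.
Proof.
move=> /MP xM; have /dominantP /(_ x)[l lC Hl] := domDC.
have [<-|lk] := eqVneq l k; first by split.
by have := xM l lC lk; rewrite ltnNge Hl // argminD_in.
Qed.

Let roomE k : (M k = set0 /\ room k = (D, C :\ k)) \/
  (exists x, [/\ x \in M k, (forall y, y \in M k -> r k y <= r k x) &
     room k = (x |: D, C)]).
Proof.
rewrite /room; case: pickP => [x0 x0M|M0].
  right; case: arg_maxnP => // x xM H; exists x; split => //.
by left; split => //; apply/setP => x; rewrite [LHS]M0 inE.
Qed.

Let room_unique k x : x \in M k -> (forall y, y \in M k -> r k y <= r k x) ->
  room k = (x |: D, C).
Proof.
move=> xM H; have [[M0 _]|[y [yM Hy ->]]] := roomE k; first by rewrite M0 inE in xM.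
congr (_ |: _, _); apply: (rI (i := k)); apply/eqP.
by rewrite eqn_leq H ?Hy.
Qed.

Let room_room k i j : k \in C -> i \in C -> i != k -> j = k -> mu i = mu j ->
  room k \in rooms /\ incident (D, C) (room k).
Proof.
move=> kC iC ik -> muik; have [[M0 ->]|[x [xM Hx ->]]] := roomE k.
  split; last by apply/incidentP; right; exists k.
  rewrite inE /= -(eqn_add2l 1) add1n -cDC (cardsD1 k C) kC eqxx andbT.
  apply/dominantP => x.
  have /nMP[l [lC lk Hl]] : x \notin M k by rewrite M0 inE.
  exists l; first by rewrite !inE lk.
  by move=> d dD; apply: leq_trans Hl _; exact: argminD_le.
(* An element of [D] in [M k] could only be [mu k]. This is also [mu i], so it is not strictly above
   the minimum of the order [i]. *)
have xD : x \notin D.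
  apply/negP => xD; have := dominant_argmin d0D domDC => muC.
  move: (xD); rewrite -muC => /imsetP[l lC xl]; rewrite -/(mu l) in xl.
  move/MP: xM => xM; have [lk|lk] := eqVneq l k.
    by have := xM i iC ik; rewrite muik -lk -xl ltnn.
  by have := xM l lC lk; rewrite -xl ltnn.
split; last by apply/incidentP; left; exists x.
rewrite inE /= cardsU1 xD cDC eqxx andbT; apply/dominantP => y.
case: (boolP (y \in M k)) => [yM|/nMP[l [lC lk Hl]]].
  exists k => // d; rewrite in_setU1 => /predU1P[->|dD]; first exact: Hx.
  exact: (M_le yM).2.
exists l => // d; rewrite in_setU1 => /predU1P[->|dD].
  by move/MP: xM => /(_ l lC lk) /ltnW; exact: leq_trans.
by apply: leq_trans Hl _; exact: argminD_le.
Qed.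

(** The rooms are [room i] and [room j] for the pair identified by [mu]. In any incident room the
    minima form a bijection, so [mu] is injective away from one index, and [collision] leaves only
    [i] and [j] for it. *)
Lemma door_rooms : #|[set p in rooms | incident (D, C) p]| = 2.
Proof.
have muC : mu @: C = D := dominant_argmin d0D domDC.
have [i [j [iC jC ij muij Hij]]] := collision muC cDC.
suff -> : [set p in rooms | incident (D, C) p] = [set room i; room j].
  rewrite cards2; case: eqVneq => // rij; exfalso.
  have [[_ ri]|[x [xM Hx ri]]] := roomE i; have [[_ rj]|[y [yM Hy rj]]] := roomE j.
  - move: rij; rewrite ri rj => -[] /setP /(_ i); rewrite !inE eqxx ij iC.
    by [].
  - move: rij; rewrite ri rj => -[_] /setP /(_ i); rewrite !inE eqxx iC.
    by [].
  - move: rij; rewrite ri rj => -[_] /setP /(_ j); rewrite !inE eqxx jC.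
    by [].
  move: rij; rewrite ri rj => -[xyD].
  have xD : x \notin D.
    apply/negP => xD; move: (xD); rewrite -muC => /imsetP[l lC xl].
    move/MP: xM => xM; have [lk|lk] := eqVneq l i.
      by have := xM j jC; rewrite eq_sym ij -muij -lk -xl ltnn => /(_ isT).
    by have := xM l lC lk; rewrite -xl ltnn.
  have xy : x = y.
    have : x \in y |: D by rewrite -xyD setU11.
    by rewrite in_setU1 (negPf xD) orbF => /eqP.
  have [_ Hi] := M_le xM; move/MP: yM; rewrite -xy => /(_ i iC ij).
  by rewrite ltnNge Hi // argminD_in.
apply/setP => p; rewrite in_set2 inE; apply/andP/orP; last first.
  move=> [/eqP ->|/eqP ->].
    by apply: (@room_room i j i) => //; rewrite eq_sym.
  exact: (@room_room j i j).
move=> [] /[1!inE] /andP[domp szp] /incidentP[[x xD pE]|[k kC pE]]; subst p.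
  rewrite /= cardsU1 xD cDC eqxx in szp.
  have muE := dominant_argmin (setU11 x D) domp.
  set nu := argminD x (x |: D) in muE.
  have nuI : {in C &, injective nu}.
    by apply/imset_injP; rewrite muE cardsU1 xD cDC.
  have [k kC xk] : exists2 k, k \in C & x = nu k.
    by apply/imsetP; rewrite muE setU11.
  have nuD l : l \in C -> l != k -> nu l = mu l /\ r l (mu l) < r l x.
    move=> lC lk; have nux : nu l != x.
      by apply: contra lk => /eqP; rewrite xk => /nuI ->.
    have nulD : nu l \in D.
      have : nu l \in x |: D by rewrite argminD_in // setU11.
      by rewrite in_setU1 (negPf nux).
    have -> : nu l = mu l.
      apply/esym/argminD_eq => // d dD; apply: argminD_le; first exact: setU11.
      by rewrite in_setU1 dD orbT.
    split => //; rewrite ltn_neqAle; apply/andP; split.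
      apply: contra xD => /eqP /(@rI l) <-; exact: argminD_in.
    apply: leq_trans (_ : r l (nu l) <= _); last exact: argminD_le (setU11 _ _) (setU11 _ _).
    by apply: argminD_le.
  have xM : x \in M k by apply/MP => l lC lk; exact: (nuD l lC lk).2.
  have -> : (x |: D, C) = room k.
    apply/esym/room_unique => // y /MP yM.
    have /dominantP /(_ y)[l lC Hl] := domp.
    have [<-|lk] := eqVneq l k; first by apply: Hl; rewrite setU11.
    have := yM l lC lk; rewrite ltnNge Hl // in_setU1 argminD_in ?orbT //.
  have [| -> | ->] := Hij k kC; [|by left|by right].
  move=> l m /setD1P[lk lC] /setD1P[mk mC].
  by rewrite -(nuD l lC lk).1 -(nuD m mC mk).1 => /nuI ->.
have muI : {in C :\ k &, injective mu}.
  apply/imset_injP; rewrite dominant_argmin //; exact/eqP.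
have -> : (D, C :\ k) = room k.
  have [[_ ->] //|[x [/MP xM _ _]]] := roomE k.
  have /dominantP /(_ x)[l /setD1P[lk lC] Hl] := domp.
  by have := xM l lC lk; rewrite ltnNge Hl // argminD_in.
by have [-> | ->] := Hij k kC muI; [left|right].
Qed.

End Door.

(** * Counting incidences of doors and rooms modulo two *)

Section Parity.
Variables (i0 : I) (x0 : X).

(** Counting elements shows that in such a door the colours of [D] are distinct and differ from
    [i0]: the colouring is complete up to [i0]. *)
Definition doors : {set {set X} * {set I}} :=
  [set q | [&& dominant q, #|q.2| == #|q.1|.+1 & q.2 == i0 |: c @: q.1]].

Lemma rainbow (D : {set X}) : #|i0 |: c @: D| = #|D|.+1 ->
  i0 \notin c @: D /\ {in D &, injective c}.
Proof.
rewrite cardsU1 => cE; have := leq_imset_card c D; move: cE.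
case: (i0 \in c @: D) => /= cE cD; first by lia.
by split=> //; apply/imset_injP; apply/eqP; lia.
Qed.

Lemma rainbowD1 (D : {set X}) C d : d \in D -> #|D| = #|C| ->
  C = i0 |: c @: (D :\ d) ->
  i0 \notin c @: (D :\ d) /\ {in D :\ d &, injective c}.
Proof. by move=> dD cE CE; apply: rainbow; rewrite -CE -cE (cardsD1 d) dD. Qed.

Lemma doors_of_roomP D C q : (D, C) \in rooms ->
  q \in [set q in doors | incident q (D, C)] <->
  (exists d, [/\ d \in D, C = i0 |: c @: (D :\ d) & q = (D :\ d, C)]) \/
  (exists i, [/\ i \notin C, i |: C = i0 |: c @: D & q = (D, i |: C)]).
Proof.
rewrite inE /= => /andP[/dominantP domp /eqP szp]; rewrite !inE; split.
  case: q => D' C' /andP[/and3P[_ /= /eqP szq /eqP CE]] /incidentP[].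
    move=> [x xD' [DE CE']]; left; exists x; subst C D.
    by rewrite setU11 setU1K.
  move=> [i iC' [DE CE']]; right; exists i; subst C D.
  by rewrite setD1K // !inE eqxx; split.
move=> [[d [dD CE ->]]|[i [iC CE ->]]]; apply/andP; split.
- rewrite /= -szp (cardsD1 d D) dD add1n -CE !eqxx !andbT.
  apply/dominantP => x; have [i iC Hi] := domp x; exists i => // d' /setD1P[_].
  exact: Hi.
- apply/incidentP; left; exists d; first by rewrite !inE eqxx.
  by rewrite setD1K.
- rewrite /= cardsU1 iC szp -CE add1n !eqxx !andbT.
  apply/dominantP => x; have [j jC Hj] := domp x; exists j => //.
  by rewrite in_setU1 jC orbT.
- by apply/incidentP; right; exists i; rewrite ?setU11 // setU1K.
Qed.

(** If [c @: D = C] there is one door: drop the element of colour [i0], or, if there is none, add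
    the order [i0]. Any other room has no door or two. If dropping [d] gives one, the second drops
    an element of the same colour as [d], or adds [c d] to [C] when that colour is missing there. *)
Lemma room_doors_odd p : p \in rooms ->
  odd #|[set q in doors | incident q p]| = (c @: p.1 == p.2).
Proof.
case: p => D C pR; have := pR; rewrite inE /= => /andP[domp /eqP szp].
pose QP q := doors_of_roomP q pR.
have [gC|ngC] := eqVneq (c @: D) C.
  have cI : {in D &, injective c} by apply/imset_injP; rewrite gC szp.
  case: (boolP (i0 \in C)) => i0C.
    have [d dD cd] : exists2 d, d \in D & i0 = c d by apply/imsetP; rewrite gC.
    have -> : [set q in doors | incident q (D, C)] = [set (D :\ d, C)].
      apply/setP => q; rewrite in_set1; apply/idP/eqP => [/QP[]|->].
      - move=> [d' [d'D CE ->]]; congr (_ :\ _, _); apply: cI => //.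
        have [+ _] := rainbowD1 d'D szp CE; rewrite -cd.
        apply: contraNeq; rewrite cd => d'd; apply: imset_f.
        rewrite !inE dD andbT; apply: contraNneq d'd => ->.
        by [].
      - by move=> [i [iC + _]]; rewrite gC => /setP/(_ i); rewrite !inE eqxx (negPf iC) /=
          orbF => /esym/eqP ii; rewrite ii i0C in iC.
      apply/QP; left; exists d; split => //.
      apply/setP => i; rewrite in_setU1 -gC cd; apply/imsetP/orP => [[e eD ->]|].
        have [->|ed] := eqVneq e d; first by left.
        by right; apply/imset_f; rewrite !inE ed.
      move=> [/eqP ->|]; first by exists d.
      by move=> /imsetP[e /setD1P[_ eD] ->]; exists e.
    by rewrite cards1.
  have -> : [set q in doors | incident q (D, C)] = [set (D, i0 |: C)].
    apply/setP => q; rewrite in_set1; apply/idP/eqP => [/QP[]|->].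
    - by move=> [d' [d'D CE ->]]; rewrite CE setU11 in i0C.
    - by move=> [i [iC CE ->]]; rewrite CE gC.
    by apply/QP; right; exists i0; rewrite i0C gC.
  by rewrite cards1.
(* A door that adds an order [i] reduces to this case: [i] is the colour of some [d] in [D], and
   dropping this [d] gives a door too. *)
suff H d : d \in D -> C = i0 |: c @: (D :\ d) ->
    exists a b, a != b /\ [set q in doors | incident q (D, C)] = [set a; b].
  have [->|[q /QP[]]] := set_0Vmem [set q in doors | incident q (D, C)].
  - by rewrite cards0.
  - by move=> [d [dD CE _]]; have [a [b [ab ->]]] := H d dD CE; rewrite cards2 ab.
  move=> [i [iC CE _]].
  have [i0D cI] : i0 \notin c @: D /\ {in D &, injective c}.
    by apply: rainbow; rewrite -CE cardsU1 iC szp.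
  have ii0 : i != i0.
    apply: contraNneq ngC => ii0; apply/eqP.
    by rewrite -(setU1K i0D) -CE ii0 setU1K // -ii0.
  have [d dD id] : exists2 d, d \in D & i = c d.
    have : i \in i0 |: c @: D by rewrite -CE setU11.
    by rewrite in_setU1 (negPf ii0) => /imsetP.
  have [| a [b [ab ->]]] := H d dD; last by rewrite cards2 ab.
  rewrite -(setU1K iC) CE; apply/setP => j; rewrite !inE.
  have [->|jj0] /= := eqVneq j i0; first by rewrite eq_sym ii0.
  apply/andP/imsetP => [[ji /imsetP[e eD je]]|[e /setD1P[ed eD] ->]].
    exists e => //; rewrite !inE eD andbT; apply: contraNneq ji => ed.
    by rewrite je ed id.
  split; last exact: imset_f.
  by apply: contraNneq ed; rewrite id => /cI ->.
move=> dD CE; have [i0D cI] := rainbowD1 dD szp CE.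
have cdi0 : c d != i0.
  apply: contraNneq ngC => cdi0; apply/eqP; rewrite -(setD1K dD) imsetU1 cdi0.
  by rewrite CE.
case: (boolP (c d \in C)) => cdC.
  have [d' d'D cdd'] : exists2 d', d' \in D :\ d & c d = c d'.
    by apply/imsetP; move: cdC; rewrite {1}CE in_setU1 (negPf cdi0).
  have /setD1P[d'd d'D'] := d'D.
  exists (D :\ d, C), (D :\ d', C); split.
    apply: contraNneq d'd => -[] /setP /(_ d'); rewrite !inE eqxx d'D' andbT /=.
    by move=> /negbFE/eqP ->.
  apply/setP => q; rewrite in_set2; apply/idP/orP => [/QP[]|].
  - move=> [e [eD CE' ->]]; have [_ cI'] := rainbowD1 eD szp CE'.
    have [->|ed] := eqVneq e d; first by left.
    have [->|ed'] := eqVneq e d'; first by right.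
    case/eqP: d'd; apply: cI' => //; rewrite !inE ?d'D' ?dD andbT eq_sym //.
  - move=> [i [iC CE' _]].
    have [_ cI'] : i0 \notin c @: D /\ {in D &, injective c}.
      by apply: rainbow; rewrite -CE' cardsU1 iC szp.
    by case/eqP: d'd; apply: cI'.
  move=> [] /eqP ->; apply/QP; left; first by exists d.
  exists d'; split => //.
  rewrite [in LHS]CE; congr (_ |: _); apply/setP => i.
  apply/imsetP/imsetP => -[e /setD1P[ne eD] ->].
    have [->|ed'] := eqVneq e d'; last by exists e => //; rewrite !inE ed'.
    by exists d; rewrite ?cdd' // !inE eq_sym d'd.
  have [->|ed] := eqVneq e d; last by exists e => //; rewrite !inE ed.
  by exists d'.
exists (D :\ d, C), (D, c d |: C); split.
  by apply: contraNneq cdC => -[_ ->]; rewrite setU11.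
apply/setP => q; rewrite in_set2; apply/idP/orP => [/QP[]|].
- move=> [e [eD CE' ->]]; have [->|ed] := eqVneq e d; first by left.
  case/negP: cdC; rewrite CE' in_setU1 imset_f ?orbT // !inE eq_sym ed.
  by [].
- move=> [i [iC CE' ->]]; right; have : c d \in i |: C.
    by rewrite CE' in_setU1 imset_f ?orbT.
  by rewrite in_setU1 (negPf cdC) orbF => /eqP ->.
move=> [] /eqP ->; apply/QP; first by left; exists d.
right; exists (c d); split => //.
by rewrite CE setUCA -imsetU1 setD1K.
Qed.

Lemma base_door : (set0, [set i0]) \in doors.
Proof.
rewrite inE /= cards0 cards1 imset0 setU0 !eqxx /= andbT.
by apply/dominantP => x; exists i0 => [|d]; rewrite !inE.
Qed.

Lemma base_door_rooms : #|[set p in rooms | incident (set0, [set i0]) p]| = 1.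
Proof.
pose m := [arg max_(x > x0) r i0 x].
have mP x : r i0 x <= r i0 m by rewrite /m; case: arg_maxnP => // y _; apply.
apply/eqP/cards1P; exists ([set m], [set i0]).
apply/setP => p; rewrite in_set1; apply/idP/eqP => [|->].
  rewrite !inE => /andP[/andP[domp szp]] /incidentP[[x _ pE]|[i iC pE]]; subst p.
    rewrite setU0 in domp *; congr ([set _], _).
    have /dominantP /(_ m)[i /set1P -> /(_ x)] := domp.
    rewrite inE => /(_ (eqxx _)) H; apply: (rI (i := i0)); apply/eqP.
    by rewrite eqn_leq mP.
  have /dominantP /(_ x0)[j] := domp.
  by move: iC; rewrite !inE => /eqP -> /andP[/negPf ->].
rewrite !inE /= !cards1 eqxx andbT; apply/andP; split.
  by apply/dominantP => x; exists i0; rewrite ?inE // => d /set1P ->.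
by apply/incidentP; left; exists m; rewrite ?inE // setU0.
Qed.

Lemma other_door_rooms q : q \in doors -> q != (set0, [set i0]) ->
  #|[set p in rooms | incident q p]| = 2.
Proof.
case: q => D C; rewrite inE /= => /and3P[domp /eqP cE /eqP CE].
have [D0|[d dD] _] := set_0Vmem D; last exact: (door_rooms dD).
by rewrite CE D0 imset0 setU0 eqxx.
Qed.

(* Incidences are counted modulo 2: every door but the one without options lies
   in two rooms, and a room (D, C) has an odd number of doors iff c @: D = C. *)
Theorem scarf_dominant : exists D C, dominant (D, C) /\ c @: D = C.
Proof.
suff : odd (\sum_(p in rooms) #|[set q in doors | incident q p]|).
  case: (boolP [exists p in rooms, c @: p.1 == p.2]) => [/exists_inP[[D C]]|H].
    by rewrite inE => /andP[domp _] /eqP cD _; exists D, C.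
  move=> od; suff : ~~ odd (\sum_(p in rooms) #|[set q in doors | incident q p]|).
    by rewrite od.
  elim/big_ind : _ => //; first by move=> m n /negPf om /negPf on; rewrite oddD om on.
  move=> p pR; rewrite room_doors_odd //; apply: contra H => cD.
  by apply/exists_inP; exists p.
have -> : \sum_(p in rooms) #|[set q in doors | incident q p]| =
    \sum_(q in doors) #|[set p in rooms | incident q p]|.
  have card_sum (T : finType) (A : {set T}) (P : pred T) :
      #|[set x in A | P x]| = \sum_(x in A) (P x : nat).
    rewrite -sum1_card (eq_bigl (fun x => (x \in A) && P x)).
      by rewrite big_mkcondr /=; apply: eq_bigr => x _; case: (P x).
    by move=> x; rewrite inE.
  under eq_bigr do rewrite card_sum.
  by rewrite exchange_big /=; apply: eq_bigr => q _; rewrite card_sum.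
rewrite (bigD1 _ base_door) /= base_door_rooms.
rewrite (eq_bigr (fun=> 2)); last by move=> q /andP[qd qn]; rewrite other_door_rooms.
by rewrite sum_nat_const oddD oddM andbF.
Qed.
End Parity.
End Scarf.

(** * Scarf's lemma on the grid points of a simplex *)

Section Grid.
Variables (I : finType) (m : nat).
Implicit Types (x d : {ffun 'I_m -> I}) (e w : I -> nat).

Definition occ i x : nat := \sum_(s < m) (x s == i).

Lemma sum_occ x : \sum_i occ i x = m.
Proof.
rewrite exchange_big /= -[RHS]card_ord -sum1_card; apply: eq_bigr => s _.
by rewrite (bigD1 (x s)) //= eqxx big1 // => i /negPf; rewrite eq_sym => ->.
Qed.

(** Each [i] in [C] is written [w i] times, and the word is padded with [i0] up to length [m]. *)
Lemma exists_occ (i0 : I) (C : {set I}) w : \sum_(i in C) w i <= m ->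
  exists x, forall i, i \in C -> w i <= occ i x.
Proof.
move=> wm; pose s := flatten [seq nseq (w i) i | i <- enum C].
have size_s : size s = \sum_(i in C) w i.
  rewrite size_flatten /shape -map_comp sumnE big_map big_enum /=.
  by apply: eq_bigr => i _; rewrite size_nseq.
have size_p : size (s ++ nseq (m - size s) i0) == m.
  by rewrite size_cat size_nseq subnKC // size_s.
exists [ffun t => tnth (Tuple size_p) t] => i iC.
have -> : occ i [ffun t => tnth (Tuple size_p) t] =
    count_mem i (s ++ nseq (m - size s) i0).
  rewrite /occ; under eq_bigr do rewrite ffunE.
  rewrite -[LHS](big_tuple _ _ (Tuple size_p) xpredT (fun j => nat_of_bool (j == i))).
  by rewrite -sum1_count [RHS]big_mkcond /=; apply: eq_bigr => j _; case: (j == i).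
rewrite count_cat; apply: leq_trans (leq_addr _ _).
rewrite count_flatten -map_comp sumnE big_map big_enum /= (bigD1 i) //=.
by rewrite count_nseq /= eqxx mul1n leq_addr.
Qed.

(* A word x stands for the point of the simplex with coordinates occ i x / m: as
   the orders compare coordinates, the points of D are close to each other. *)
Lemma grid_dominant (i0 : I) (c : {ffun 'I_m -> I} -> I) :
  exists (D : {set {ffun 'I_m -> I}}) e, [/\ D != set0,
    forall d i, d \in D -> e i <= occ i d, m <= \sum_i e i + #|I| &
    forall i, 0 < e i -> exists2 d, d \in D & c d = i].
Proof.
pose N := #|{ffun 'I_m -> I}|.
(* Ties between equal coordinates are broken by the rank, which is below [N]: the orders become
   injective and still compare coordinates. *)
pose r i (x : {ffun 'I_m -> I}) := occ i x * N + enum_rank x.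
have r_le i x y : r i x <= r i y -> occ i x <= occ i y.
  rewrite /r => rxy; have := ltn_ord (enum_rank y); rewrite -/N => yN.
  rewrite leqNgt; apply/negP => xy; have : (occ i y).+1 * N <= occ i x * N.
    by rewrite leq_mul2r xy orbT.
  rewrite mulSn leqNgt => /negP; apply; rewrite addnC.
  apply: leq_ltn_trans (leq_addr (enum_rank x) _) _; apply: leq_ltn_trans rxy _.
  by rewrite ltn_add2l.
have rI i : injective (r i).
  move=> x y rxy; have oxy : occ i x = occ i y.
    by apply/eqP; rewrite eqn_leq !r_le ?rxy.
  apply/enum_rank_inj/val_inj/eqP; move: rxy; rewrite /r oxy => /eqP.
  by rewrite eqn_add2l.
have [D [C [/dominantP dDC cD]]] := scarf_dominant c rI i0 [ffun=> i0].
have [j jC _] := dDC [ffun=> i0].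
have [d0 d0D _] : exists2 d, d \in D & j = c d by apply/imsetP; rewrite cD.
pose mu := argminD r d0 D.
pose e i := if i \in C then occ i (mu i) else 0.
exists D, e; split.
- by apply/set0Pn; exists d0.
- move=> d i dD; rewrite /e; case: ifP => // _.
  by apply: r_le; apply: argminD_le.
(* If the minima had a smaller sum, some word would exceed each of them by one on [C], against
   dominance. *)
- rewrite leqNgt; apply/negP => em.
  have [|x xP] := @exists_occ i0 C (fun i => (e i).+1).
    apply: leq_trans (ltnW em); rewrite (eq_bigr (fun i => e i + 1)).
      rewrite big_split /= sum1_card leq_add ?max_card //.
      by rewrite [leqRHS](bigID (mem C)) /= leq_addr.
    by move=> i _; rewrite addn1.
  have [i iC Hi] := dDC x; have := r_le _ _ _ (Hi (mu i) (argminD_in _ _ d0D)).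
  by have := xP i iC; rewrite /e iC ltnNge => /negPf ->.
move=> i; rewrite /e; case: ifP => // iC _.
have [d dD id] : exists2 d, d \in D & i = c d by apply/imsetP; rewrite cD.
by exists d.
Qed.

End Grid.

From mathcomp Require Import all_classical all_reals all_analysis.

Import Order.TTheory GRing.Theory Num.Theory.
Import numFieldNormedType.Exports.

Local Open Scope classical_set_scope.
Local Open Scope ring_scope.

(** * Hahn-Banach *)

Section RealInf.
Context {R : realType}.
Implicit Types (A : set R) (m : R).

Lemma inf_lower A m a : (forall b, A b -> m <= b) -> A a -> inf A <= a.
Proof. by move=> Am Aa; apply: ge_inf => //; exists m => b; exact: Am. Qed.

Lemma le_inf_of A m : A !=set0 -> (forall b, A b -> m <= b) -> m <= inf A.
Proof. by move=> A0 Am; apply: lb_le_inf. Qed.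

End RealInf.

Section Sublinear.
Context {R : realType} {V : lmodType R}.
Implicit Types (p q f : V -> R).

Definition sublinear p : Prop :=
  (forall x y, p (x + y) <= p x + p y) /\
  (forall (a : R) x, 0 <= a -> p (a *: x) <= a * p x).

Definition linear_form f : Prop :=
  (forall x y, f (x + y) = f x + f y) /\ (forall (a : R) x, f (a *: x) = a * f x).

Lemma linear_formN f x : linear_form f -> f (- x) = - f x.
Proof. by move=> [_ fZ]; rewrite -scaleN1r fZ mulN1r. Qed.

Lemma linear_formB f x y : linear_form f -> f (x - y) = f x - f y.
Proof. by move=> lf; rewrite lf.1 linear_formN. Qed.

Lemma linear_form0 f : linear_form f -> f 0 = 0.
Proof. by move=> [_ fZ]; rewrite -(scale0r 0) fZ mul0r. Qed.

Lemma linear_form_sum f (I : Type) (s : seq I) (P : pred I) (F : I -> V) :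
  linear_form f -> f (\sum_(i <- s | P i) F i) = \sum_(i <- s | P i) f (F i).
Proof.
move=> lf; elim/big_rec2 : _ => [|i y z _ <-]; first exact: linear_form0.
exact: lf.1.
Qed.

Lemma sublinear0 p : sublinear p -> p 0 = 0.
Proof.
move=> [pD pZ]; apply/eqP; rewrite eq_le -[X in p X](scale0r 0).
rewrite (le_trans (pZ _ _ _)) ?mul0r //= scale0r.
by have := pD 0 0; rewrite addr0; lra.
Qed.

Lemma sublinear_ge p x : sublinear p -> - p (- x) <= p x.
Proof.
move=> sp; have := sp.1 x (- x); rewrite subrr sublinear0 //; lra.
Qed.

Lemma sublinearZ p a x : sublinear p -> 0 <= a -> p (a *: x) = a * p x.
Proof.
move=> sp; rewrite le_eqVlt => /predU1P[<-|a0].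
  by rewrite scale0r mul0r sublinear0.
apply/eqP; rewrite eq_le (sp.2 _ _ (ltW a0)) /= -ler_pdivlMl //.
by rewrite -{1}[x](scalerK (lt0r_neq0 a0)) sp.2 // invr_ge0 ltW.
Qed.

(** Taking [t = 0] puts it below [q], and [t = 1] bounds it by [q (x + y) - q y]. For a minimal [q]
    the two together give superadditivity. *)
Let pullback q y x : R := inf [set q (x + t *: y) - t * q y | t in [set t | 0 <= t]].

Let pullback_ge q y x t : sublinear q -> 0 <= t ->
  - q (- x) <= q (x + t *: y) - t * q y.
Proof.
move=> sq t0; have := sq.1 (- x) (x + t *: y).
by rewrite addrA addNr add0r sublinearZ //; lra.
Qed.

Let pullback_le q y x t : sublinear q -> 0 <= t ->
  pullback q y x <= q (x + t *: y) - t * q y.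
Proof.
move=> sq t0; apply: (@inf_lower _ _ (- q (- x))); last by exists t.
by move=> _ [s s0 <-]; exact: pullback_ge.
Qed.

Let le_pullback q y x m :
  (forall t, 0 <= t -> m <= q (x + t *: y) - t * q y) -> m <= pullback q y x.
Proof.
move=> H; apply: le_inf_of; last by move=> _ [t t0 <-]; exact: H.
by exists (q (x + 0 *: y) - 0 * q y); exists 0 => //=.
Qed.

Let pullback_sublinear q y : sublinear q -> sublinear (pullback q y).
Proof.
move=> sq; split=> [x x'|a x].
  rewrite -lerBlDr; apply: le_pullback => t t0; rewrite lerBlDr -lerBlDl.
  apply: le_pullback => s s0; rewrite lerBlDl.
  apply: le_trans (pullback_le y _ sq (addr_ge0 t0 s0)) _.
  rewrite scalerDl mulrDl addrACA.
  by have := sq.1 (x + t *: y) (x' + s *: y); lra.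
rewrite le_eqVlt => /predU1P[<-|a0].
  rewrite scale0r mul0r; apply: le_trans (pullback_le y _ sq (lexx 0)) _.
  by rewrite scale0r addr0 mul0r subr0 sublinear0.
rewrite -ler_pdivrMl //; apply: le_pullback => t t0; rewrite ler_pdivrMl //.
apply: le_trans (pullback_le y _ sq (mulr_ge0 (ltW a0) t0)) _.
by rewrite -scalerA -scalerDr (sublinearZ _ sq (ltW a0)); lra.
Qed.

(* A minimal sublinear functional is linear: it cannot lie above its own
   modification in any direction. *)
Lemma sublinear_dominates_linear p : sublinear p ->
  exists f, linear_form f /\ forall x, f x <= p x.
Proof.
move=> sp.
pose T := {q : V -> R | sublinear q /\ forall x, q x <= p x}.
(* The order is reversed since Zorn's lemma produces maximal elements. A nonempty chain is bounded
   by its pointwise infimum, which is finite because every [q] in [T] satisfies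
   [q x >= - p (- x)]. *)
pose below (q1 q2 : T) : bool := `[< forall x, sval q2 x <= sval q1 x >].
have belowP (q1 q2 : T) : reflect (forall x, sval q2 x <= sval q1 x) (below q1 q2).
  exact: asboolP.
have pT : sublinear p /\ forall x, p x <= p x by [].
have [||A totA|[q [sq qp]] qmin] := @ZL_preorder T (exist _ p pT) below.
- by move=> q; apply/belowP.
- move=> q1 q2 q3 /belowP q12 /belowP q23; apply/belowP => x.
  exact: le_trans (q23 x) (q12 x).
- have [[q0 Aq0]|A0] := pselect (A !=set0); last first.
    exists (exist _ p pT) => q Aq; exfalso; apply: A0; by exists q.
  pose g x := inf [set sval q x | q in (A : set T)].
  have gle (q : T) x : A q -> g x <= sval q x.
    move=> Aq; apply: (@inf_lower _ _ (- p (- x))); last by exists q.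
    move=> _ [q' Aq' <-]; have [sq' q'p] := svalP q'.
    by apply: le_trans (sublinear_ge x sq'); rewrite lerN2.
  have leg m x : (forall q : T, A q -> m <= sval q x) -> m <= g x.
    move=> H; apply: le_inf_of; first by exists (sval q0 x), q0.
    by move=> _ [q Aq <-]; exact: H.
  have sg : sublinear g.
    split=> [x y|a x].
      rewrite -lerBlDr; apply: (leg) => q1 Aq1; rewrite lerBlDr -lerBlDl.
      apply: (leg) => q2 Aq2; rewrite lerBlDl.
      have [/belowP q12|/belowP q21] := totA _ _ Aq1 Aq2.
        apply: le_trans (gle _ _ Aq2) _.
        by apply: le_trans ((svalP q2).1.1 x y) _; rewrite lerD2r.
      apply: le_trans (gle _ _ Aq1) _.
      by apply: le_trans ((svalP q1).1.1 x y) _; rewrite lerD2l.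
    rewrite le_eqVlt => /predU1P[<-|a0].
      rewrite scale0r mul0r; apply: le_trans (gle _ _ Aq0) _.
      by rewrite (sublinear0 (svalP q0).1).
    rewrite -ler_pdivrMl //; apply: (leg) => q Aq; rewrite ler_pdivrMl //.
    by apply: le_trans (gle _ _ Aq) _; apply: (svalP q).1.2; exact: ltW.
  have gT : sublinear g /\ forall x, g x <= p x.
    by split => // x; apply: le_trans (gle _ _ Aq0) ((svalP q0).2 x).
  by exists (exist _ g gT) => q Aq; apply/belowP => x; exact: gle.
exists q; split=> //.
have qD x y : q (x + y) = q x + q y.
  apply/eqP; rewrite eq_le sq.1 /=.
  have pbT : sublinear (pullback q y) /\ forall x, pullback q y x <= p x.
    split; first exact: pullback_sublinear.
    move=> z; apply: le_trans (pullback_le y _ sq (lexx 0)) _.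
    by rewrite scale0r addr0 mul0r subr0.
  have /belowP /(_ x) /= : below (exist _ (pullback q y) pbT) (exist _ q (conj sq qp)).
    apply: qmin; apply/belowP => z /=.
    apply: le_trans (pullback_le y _ sq (lexx 0)) _.
    by rewrite scale0r addr0 mul0r subr0.
  have := pullback_le y x sq ler01; rewrite scale1r mul1r; lra.
have qN x : q (- x) = - q x.
  by apply/eqP; rewrite -addr_eq0 -qD addNr sublinear0.
split=> // a x; have [a0|a0] := leP 0 a; first exact: sublinearZ.
by rewrite -[a]opprK scaleNr qN sublinearZ ?mulNr // oppr_ge0 ltW.
Qed.

End Sublinear.

(** * Separation of convex sets *)

Section Separation.
Context {R : realType} {E : normedModType R}.
Implicit Types (f : E -> R) (M : R) (x y : E) (W : set E).

Definition blin M f : Prop := linear_form f /\ forall x, `|f x| <= M * `|x|.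

Lemma blin_dist M f x y : blin M f -> `|f x - f y| <= M * `|x - y|.
Proof. by move=> [lf fM]; rewrite -linear_formB. Qed.

Definition convex W : Prop :=
  forall x y (t : R), 0 <= t <= 1 -> W x -> W y -> W (t *: x + (1 - t) *: y).

(* The functional [v |-> inf |v + t (m - x0)| - t d] is sublinear because the
   vectors [t (m - x0)] form a convex cone. *)
Lemma convex_separation W x0 (d : R) : convex W -> W !=set0 -> 0 <= d ->
  (forall w, W w -> d <= `|w - x0|) ->
  exists f, blin 1 f /\ forall w, W w -> f x0 + d <= f w.
Proof.
move=> cW [w0 Ww0] d0 Wd.
pose S v := [set z | exists t w, [/\ 0 <= t, W w & z = `|v + t *: (w - x0)| - t * d]].
pose p v := inf (S v).
have Sge v t w : 0 <= t -> W w -> - `|v| <= `|v + t *: (w - x0)| - t * d.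
  move=> t0 Ww; have : t * d <= `|t *: (w - x0)|.
    by rewrite normrZ ger0_norm // ler_wpM2l // Wd.
  have := ler_normB (v + t *: (w - x0)) v; rewrite addrAC subrr add0r; lra.
have ple v t w : 0 <= t -> W w -> p v <= `|v + t *: (w - x0)| - t * d.
  move=> t0 Ww; apply: (@inf_lower _ _ (- `|v|)); last by exists t, w.
  by move=> _ [s [u [s0 Wu ->]]]; exact: Sge.
have lep v m :
    (forall t w, 0 <= t -> W w -> m <= `|v + t *: (w - x0)| - t * d) -> m <= p v.
  move=> H; apply: le_inf_of; last by move=> _ [s [u [s0 Wu ->]]]; exact: H.
  by exists (`|v + 0 *: (w0 - x0)| - 0 * d), 0, w0.
have sp : sublinear p.
  split=> [x y|a x].
    rewrite -lerBlDr; apply: (lep) => t w t0 Ww; rewrite lerBlDr -lerBlDl.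
    apply: (lep) => s u s0 Wu; rewrite lerBlDl.
    (* The sum of the two cone vectors is the one with parameter [t + s] at a convex combination of
       [w] and [u], unless both parameters vanish. *)
    have [ts0|ts0] := eqVneq (t + s) 0.
      have -> : t = 0 by lra.
      have -> : s = 0 by lra.
      apply: le_trans (ple _ 0 w0 (lexx 0) Ww0) _.
      rewrite !scale0r !addr0 !mul0r !subr0; exact: ler_normD.
    have tsp : 0 < t + s by lra.
    pose k := t / (t + s).
    have k01 : 0 <= k <= 1.
      by rewrite /k (divr_ge0 t0 (ltW tsp)) ler_pdivrMr // mul1r; lra.
    have := ple (x + y) (t + s) _ (ltW tsp) (cW _ _ _ k01 Ww Wu).
    have -> : (t + s) *: (k *: w + (1 - k) *: u - x0) = t *: (w - x0) + s *: (u - x0).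
      have ks : (t + s) * (1 - k) = s by rewrite /k; field.
      have kt : (t + s) * k = t by rewrite /k; field.
      rewrite !scalerBr scalerDr !scalerA kt ks scalerDl opprD.
      by rewrite addrACA.
    rewrite addrACA; have := ler_normD (x + t *: (w - x0)) (y + s *: (u - x0)); lra.
  rewrite le_eqVlt => /predU1P[<-|a0].
    rewrite scale0r mul0r; apply: le_trans (ple _ 0 w0 (lexx 0) Ww0) _.
    by rewrite scale0r addr0 normr0 mul0r subr0.
  rewrite -ler_pdivrMl //; apply: (lep) => t w t0 Ww; rewrite ler_pdivrMl //.
  apply: le_trans (ple _ (a * t) w (mulr_ge0 (ltW a0) t0) Ww) _.
  by rewrite -scalerA -scalerDr normrZ gtr0_norm // mulrBr mulrA.
have [f [lf fp]] := sublinear_dominates_linear sp.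
have pn v : p v <= `|v|.
  by apply: le_trans (ple _ 0 w0 (lexx 0) Ww0) _; rewrite scale0r addr0 mul0r subr0.
exists f; split.
  split => // x; rewrite mul1r ler_norml (le_trans (fp x) (pn x)) andbT.
  by rewrite lerNl -(linear_formN _ lf) (le_trans (fp _)) // (le_trans (pn _)) // normrN.
(* With parameter 1 at [w], the infimum defining [p (x0 - w)] is at most [- d]. *)
move=> w Ww; have := fp (x0 - w); have := ple (x0 - w) 1 w ler01 Ww.
rewrite scale1r addrA subrK subrr normr0 (linear_formB _ _ lf); lra.
Qed.

Lemma norming_functional x : exists f, blin 1 f /\ f x = `|x|.
Proof.
have [||||f [bf fx]] := @convex_separation [set x] 0 `|x|.
- by move=> _ _ t _ -> ->; rewrite -scalerDl addrC subrK scale1r.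
- by exists x.
- exact: normr_ge0.
- by move=> _ ->; rewrite subr0.
exists f; split => //; have := fx x erefl; have := bf.2 x.
rewrite (linear_form0 bf.1) mul1r add0r => /(le_trans (ler_norm _)) h1 h2.
by apply/eqP; rewrite eq_le h1.
Qed.

End Separation.

(** * Ultrafilters and weak limits *)

Section Ultrafilters.

Lemma ultraP T (F : set_system T) : ProperFilter F ->
  (forall A, F A \/ F (~` A)) -> UltraFilter F.
Proof.
move=> FF dich; split=> // G GF FG; apply/seteqP; split=> // A GA.
have [//|/FG GnA] := dich A.
have : G (A `&` ~` A) by exact: filterI.
by move=> /filter_ex[x []].
Qed.

Lemma ultra_fmap T T' (f : T -> T') (F : set_system T) :
  UltraFilter F -> UltraFilter (f @ F).
Proof.
by move=> FU; apply: ultraP => A; exact: (in_ultra_setVsetC (f @^-1` A) FU).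
Qed.

Lemma free_ultrafilter : exists U : set_system nat, UltraFilter U /\ \oo `<=` U.
Proof. exact: ultraFilterLemma. Qed.

Lemma ultra_not T (U : set_system T) (A : set T) :
  UltraFilter U -> ~ U A -> U (~` A).
Proof. by move=> UU nUA; have [] := in_ultra_setVsetC A UU. Qed.

(** The limit along [V] of the ultrafilters [W x]: it turns a limit of limits of one sequence into a
    single limit of that sequence. *)
Definition ultra_join T T' (V : set_system T) (W : T -> set_system T') :
  set_system T' := [set A | V [set x | W x A]].

Lemma ultra_join_ultra T T' (V : set_system T) (W : T -> set_system T') :
  UltraFilter V -> (forall x, UltraFilter (W x)) -> UltraFilter (ultra_join V W).
Proof.
move=> VU WU; have jF : ProperFilter (ultra_join V W).
  apply: Build_ProperFilter_ex.
    move=> A VA; have [x WxA] := filter_ex (VA : V [set x | W x A]).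
    exact: filter_ex WxA.
  split.
  - by rewrite /ultra_join /=; apply: filterE => x; exact: filterT.
  - move=> A B; rewrite /ultra_join /= => VA VB.
    by apply: filterS (filterI VA VB) => x [WA WB]; exact: filterI.
  - by move=> A B AB; rewrite /ultra_join /=; apply: filterS => x; exact: filterS.
apply: ultraP => A.
have [VA|VnA] := in_ultra_setVsetC [set x | W x A] VU; [by left|right].
by rewrite /ultra_join /=; apply: filterS VnA => x /= /(ultra_not (WU x)).
Qed.

End Ultrafilters.

Section RealLimits.
Context {R : realType} {T : Type}.
Implicit Types (F : set_system T) (g h : T -> R) (a b c l e : R).

Lemma cvg_dist F {FF : Filter F} g l e :
  g @ F --> l -> 0 < e -> F [set t | `|g t - l| < e].
Proof. by move=> /cvgrPdistC_lt H /H. Qed.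

Lemma cvg_le_bound F {FF : ProperFilter F} g l c :
  g @ F --> l -> F [set t | g t <= c] -> l <= c.
Proof.
move=> gl gc; rewrite leNgt; apply/negP => cl.
have lc : 0 < l - c by rewrite subr_gt0.
have gF : F [set t | `|g t - l| < l - c] by exact: cvg_dist.
have : F ([set t | g t <= c] `&` [set t | `|g t - l| < l - c]) by exact: filterI.
move=> /filter_ex [t [] /= h1]; have := ler_norm (l - g t); rewrite distrC; lra.
Qed.

Lemma cvg_ge_bound F {FF : ProperFilter F} g l c :
  g @ F --> l -> F [set t | c <= g t] -> c <= l.
Proof.
move=> gl gc; rewrite -lerN2; apply: (@cvg_le_bound F _ (fun t => - g t)).
  exact: cvgN.
by apply: filterS gc => t /=; rewrite lerN2.
Qed.

Lemma cvg_norm_bound F {FF : ProperFilter F} g l c :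
  g @ F --> l -> F [set t | `|g t| <= c] -> `|l| <= c.
Proof.
move=> gl gc; rewrite ler_norml; apply/andP; split.
  by apply: (cvg_ge_bound gl); apply: filterS gc => t /=; rewrite ler_norml => /andP[].
by apply: (cvg_le_bound gl); apply: filterS gc => t /=; rewrite ler_norml => /andP[].
Qed.

Lemma cvg_maxr F {FF : Filter F} g h a b :
  g @ F --> a -> h @ F --> b -> Num.max (g t) (h t) @[t --> F] --> Num.max a b.
Proof.
move=> ga hb; rewrite maxr_absE; under eq_fun do rewrite maxr_absE.
apply: cvgM; last exact: cvg_cst.
by apply: cvgD; [exact: cvgD|apply: (@cvg_norm R R); exact: cvgB].
Qed.

Lemma cvg_minr F {FF : Filter F} g h a b :
  g @ F --> a -> h @ F --> b -> Num.min (g t) (h t) @[t --> F] --> Num.min a b.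
Proof.
move=> ga hb; rewrite minr_absE; under eq_fun do rewrite minr_absE.
apply: cvgM; last exact: cvg_cst.
by apply: cvgB; [exact: cvgD|apply: (@cvg_norm R R); exact: cvgB].
Qed.

Lemma ultra_bounded_cvg (U : set_system T) g c : UltraFilter U ->
  U [set t | `|g t| <= c] -> exists l, g @ U --> l.
Proof.
move=> UU gc; have := @segment_compact R (- c) c; rewrite compact_ultra.
move=> /(_ (g @ U) (ultra_fmap g UU)) [|l [_ lU]]; last by exists l.
by apply: (@filterS _ U _ _ (g @^-1` `[- c, c]) _ gc) => t; rewrite /= ler_norml in_itv.
Qed.

End RealLimits.

Lemma near_harmonic (R : realType) (d : R) : 0 < d -> \forall m \near \oo, (m.+1%:R^-1 : R) < d.
Proof.
move=> d0; have := @cvg_harmonic R; move=> /cvgr0_norm_lt /(_ _ d0).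
by apply: filterS => m; rewrite /= ger0_norm // invr_ge0.
Qed.

Section WeakLimits.
Context {R : realType} {E : completeNormedModType R}.
Implicit Types (f : E -> R) (M : R) (x y : E) (W : set E) (u v : nat -> E).

Definition wlim T (F : set_system T) (u : T -> E) (x : E) : Prop :=
  forall M f, blin M f -> f (u t) @[t --> F] --> f x.

Lemma blin_continuous M f : blin M f ->
  exists2 g : {linear E -> R^o}, continuous g & f =1 g.
Proof.
move=> [lf fM].
have flin : linear (f : E -> R^o) by move=> a x y; rewrite lf.1 lf.2.
pose aux := GRing.isLinear.Build R E R^o *:%R (f : E -> R^o) flin.
pose g : {linear E -> R^o} := HB.pack (f : E -> R^o) aux.
exists g => //; apply: bounded_linear_continuous; apply/linear_boundedP.
near=> r => x; apply: le_trans (fM x) _; apply: ler_wpM2r => //.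
Unshelve. all: by end_near. Qed.

Lemma continuous_blin (g : {linear E -> R^o}) : continuous g ->
  exists M, blin M (g : E -> R).
Proof.
move=> /(_ 0) /continuous_linear_bounded -/(_ 0) /linear_boundedP.
move=> /pinfty_ex_gt0 [M _ gM]; exists M; split => //.
by split => [x y|a x]; [exact: linearD|exact: linearZ].
Qed.

Lemma weak_cvg_wlim u x : weak_cvg u x <-> wlim \oo u x.
Proof.
rewrite weak_cvgP; split=> [H M f /blin_continuous[g cg fg]|H g cg].
  rewrite fg (_ : (fun t => f (u t)) = fun t => g (u t)); first exact: H.
  by apply/funext => t; rewrite fg.
by have [M bg] := continuous_blin cg; apply: H bg.
Qed.

Lemma cvg_weak (F : set_system E) (x : E) : Filter F ->
  (F : set_system (weak E)) --> (x : weak E) <-> wlim F id x.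
Proof.
move=> FF; rewrite cvg_sup; split=> [H M f /blin_continuous[g cg fg]|H [f cf]].
  rewrite fg (_ : (fun t => f (id t)) = g); last by apply/funext => t; rewrite fg.
  exact: continuous_cvg (@initial_continuous E R^o g x)
    (H (exist _ g cg : dual E)).
move=> V [_ [[B oB <-] Bx sBV]].
have [M bf] := continuous_blin cf.
by apply: filterS sBV _; apply: (H M f bf); exact: open_nbhs_nbhs.
Qed.

Lemma wlim_cst T (F : set_system T) {FF : Filter F} x : wlim F (fun=> x) x.
Proof. by move=> M f _; exact: cvg_cst. Qed.

Lemma wlimD T (F : set_system T) {FF : Filter F} (u v : T -> E) x y :
  wlim F u x -> wlim F v y -> wlim F (fun t => u t + v t) (x + y).
Proof.
move=> ux vy M f bf; rewrite bf.1.1.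
under eq_fun do rewrite bf.1.1.
by apply: cvgD; [apply: ux bf|apply: vy bf].
Qed.

Lemma wlimB T (F : set_system T) {FF : Filter F} (u v : T -> E) x y :
  wlim F u x -> wlim F v y -> wlim F (fun t => u t - v t) (x - y).
Proof.
move=> ux vy M f bf; rewrite (linear_formB _ _ bf.1).
under eq_fun do rewrite (linear_formB _ _ bf.1).
by apply: cvgB; [apply: ux bf|apply: vy bf].
Qed.

Lemma wlim_fmap T T' (s : T' -> T) (F : set_system T') (u : T -> E) x :
  wlim (s @ F) u x <-> wlim F (u \o s) x.
Proof. by []. Qed.

Lemma wlim_sub T (F G : set_system T) (u : T -> E) x :
  F `<=` G -> wlim F u x -> wlim G u x.
Proof. by move=> FG ux M f bf A /(ux M f bf); exact: FG. Qed.

Lemma wlim_norm_le T (F : set_system T) {FF : ProperFilter F} (u : T -> E) x M :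
  wlim F u x -> F [set t | `|u t| <= M] -> `|x| <= M.
Proof.
move=> ux uM; have [f [bf <-]] := norming_functional x.
apply: (cvg_le_bound (ux _ _ bf)); apply: filterS uM => t /= utM.
apply: le_trans utM; apply: le_trans (ler_norm _) _.
by have := bf.2 (u t); rewrite mul1r.
Qed.

Lemma wlim_dist_le T (F : set_system T) {FF : ProperFilter F} (u v : T -> E) x y e :
  wlim F u x -> wlim F v y -> F [set t | `|u t - v t| <= e] -> `|x - y| <= e.
Proof. by move=> ux vy; apply: wlim_norm_le; exact: wlimB. Qed.

Lemma wlim_unique T (F : set_system T) {FF : ProperFilter F} (u : T -> E) x y :
  wlim F u x -> wlim F u y -> x = y.
Proof.
move=> ux uy; apply/eqP; rewrite -subr_eq0 -normr_le0.
apply: (wlim_dist_le ux uy); apply: filterE => t /=.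
by rewrite subrr normr0.
Qed.

Lemma closed_separated W x : closed W -> ~ W x ->
  exists2 d : R, 0 < d & forall w, W w -> d <= `|w - x|.
Proof.
move=> cW nWx; have : nbhs x (~` W).
  by apply: open_nbhs_nbhs; split=> //; exact: closed_openC.
move=> /nbhs_ballP[d /= d0 dW]; exists d => // w Ww; rewrite leNgt; apply/negP => wd.
by apply: (dW w) => //; rewrite -ball_normE /= distrC.
Qed.

Lemma closed_convex_separation W x : closed W -> convex W -> W !=set0 -> ~ W x ->
  exists f d, [/\ blin 1 f, 0 < d & forall w, W w -> f x + d <= f w].
Proof.
move=> cW vW W0 nWx; have [d d0 dW] := closed_separated cW nWx.
by have [f [bf fW]] := convex_separation vW W0 (ltW d0) dW; exists f, d.
Qed.

Lemma mazur T (F : set_system T) {FF : ProperFilter F} (u : T -> E) x W :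
  closed W -> convex W -> F [set t | W (u t)] -> wlim F u x -> W x.
Proof.
move=> cW vW uW ux; apply: contrapT => nWx.
have [t0 Wt0] := filter_ex uW.
have [|f [d [bf d0 fW]]] := closed_convex_separation cW vW _ nWx.
  by exists (u t0).
have : f x + d <= f x.
  by apply: (cvg_ge_bound (ux _ _ bf)); apply: filterS uW => t /fW.
lra.
Qed.

(* The sequence u is relatively weakly compact. *)
Definition relwcs u : Prop :=
  forall U, UltraFilter U -> exists x, wlim U u x.

Lemma relwcs_comp u (s : nat -> nat) : relwcs u -> relwcs (u \o s).
Proof. by move=> uc U UU; apply: (uc (s @ U)); exact: ultra_fmap. Qed.

Lemma relwcsD u v : relwcs u -> relwcs v -> relwcs (fun n => u n + v n).
Proof.
move=> uc vc U UU; have [x ux] := uc U UU; have [y vy] := vc U UU.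
by exists (x + y); exact: wlimD.
Qed.

Lemma weakly_compact_relwcs (K : set E) u : weakly_compact K ->
  (forall n, K (u n)) -> relwcs u.
Proof.
rewrite /weakly_compact compact_ultra => Kc uK U UU.
have uKU : U [set n | K (u n)] by exact: filterE.
have [x [_ ux]] := Kc (u @ U) (ultra_fmap u UU) uKU.
exists x; apply/(@wlim_fmap _ _ u U id x).
by apply: (iffLR (cvg_weak x _)) ux.
Qed.

(** [K] consists of all limits of [u] along ultrafilters. Given an ultrafilter [V] on [K], pick for
    each [x] an ultrafilter [W x] along which [u] tends to [x]; the limit of [u] along the join of
    the [W x] is the limit of [V]. *)
Lemma relwcs_weakly_compact u : relwcs u ->
  exists2 K : set E, weakly_compact K & forall n, K (u n).
Proof.
move=> uc; pose K := [set x | exists2 U, UltraFilter U & wlim U u x].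
exists K; last first.
  move=> n; exists (principal_filter n); first exact: principal_filter_ultra.
  move=> M f bf A /nbhs_singleton Afu.
  exact/principal_filterP.
rewrite /weakly_compact compact_ultra => V VU VK.
have /choice[W WP] : forall x, exists U, UltraFilter U /\ (K x -> wlim U u x).
  move=> x; have [[U UU Ux]|nKx] := pselect (K x); first by exists U.
  have [U [UU _]] := free_ultrafilter; by exists U.
have WU x : UltraFilter (W x) by have [] := WP x.
have JU : UltraFilter (ultra_join V W) := ultra_join_ultra VU WU.
have [z uz] := uc _ JU; exists z; split; first by exists (ultra_join V W).
apply: (iffRL (cvg_weak z _)) => M f bf; apply/cvgrPdistC_le => e e0.
have : V [set x | W x [set n | `|f (u n) - f z| < e]].
  exact: cvg_dist (uz _ _ bf) e0.
move=> Ve; apply: filterS (filterI VK Ve) => x [Kx We].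
have fux := (WP x).2 Kx M f bf.
rewrite /=; apply: (@cvg_norm_bound _ _ (W x) _ (fun n => f (u n) - f z)).
  by apply: cvgB => //; exact: cvg_cst.
by apply: filterS We => n /ltW.
Qed.

Lemma harmonic_cauchy u :
  (forall m n, `|u m - u n| <= m.+1%:R^-1 + n.+1%:R^-1) -> exists l : E, u @ \oo --> l.
Proof.
move=> ud; suff : cvg (u @ \oo) by move=> ul; exists (lim (u @ \oo)).
apply/cauchy_cvgP/cauchy_ballP => d d0.
have d2 : 0 < d / 2 by rewrite divr_gt0.
rewrite near_map2; near=> m m' => /=; rewrite -ball_normE /=.
apply: le_lt_trans (ud m m') _; rewrite [d]splitr; apply: ltrD.
  by near: m; exact: near_harmonic.
by near: m'; exact: near_harmonic.
Unshelve. all: by end_near. Qed.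

(** Grothendieck's criterion. Along an ultrafilter, the limits of the approximating sequences are
    Cauchy because the norm is weakly lower semicontinuous, and [u] tends weakly to their norm
    limit. *)
Lemma relwcs_approx u :
  (forall e : R, 0 < e -> exists2 k, relwcs k & forall n, `|u n - k n| <= e) ->
  relwcs u.
Proof.
move=> H U UU.
pose e m : R := m.+1%:R^-1.
have e0 m : 0 < e m by rewrite invr_gt0 ltr0n.
have /choice[k kP] : forall m, exists k, relwcs k /\ forall n, `|u n - k n| <= e m.
  by move=> m; have [k kc uk] := H _ (e0 m); exists k.
have /choice[y yP] : forall m, exists y, wlim U (k m) y.
  by move=> m; exact: (kP m).1.
have yd m m' : `|y m - y m'| <= e m + e m'.
  apply: (wlim_dist_le (yP m) (yP m')); apply: filterE => n /=.
  have -> : k m n - k m' n = (k m n - u n) + (u n - k m' n) by rewrite addrA subrK.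
  by apply: le_trans (ler_normD _ _) _; rewrite lerD ?(kP m').2 // distrC (kP m).2.
have [l yl] := harmonic_cauchy yd.
exists l => M f bf; apply/cvgrPdistC_le => d d0.
have M0 : 0 <= `|M| by [].
pose d' := d / (3 * (`|M| + 1)).
have d'0 : 0 < d' by rewrite /d' divr_gt0 // mulr_gt0 // ltr_wpDl.
have Md' a : a <= d' -> 0 <= a -> M * a <= d / 3.
  move=> ad a0; apply: le_trans (ler_norm _) _; rewrite normrM (ger0_norm a0).
  apply: le_trans (_ : (`|M| + 1) * d' <= _); first by apply: ler_pM => //; lra.
  have M1 : `|M| + 1 != 0 by rewrite gt_eqF // ltr_wpDl.
  by rewrite (_ : _ * d' = d / 3) // /d'; field.
have [m [em ym]] : exists m, e m <= d' /\ `|y m - l| <= d'.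
  move/cvgrPdistC_lt: yl => /(_ _ d'0) yl.
  have : \forall m \near \oo, e m < d' /\ `|y m - l| < d'.
    by near=> m; split; near: m; [exact: near_harmonic|exact: yl].
  by move=> /filter_ex[m [h1 h2]]; exists m; split; exact: ltW.
have d3 : 0 < d / 3 by rewrite divr_gt0.
have : U [set n | `|f (k m n) - f (y m)| < d / 3].
  exact: cvg_dist (yP m _ _ bf) d3.
apply: filterS => n /= kn.
have h1 : `|f (u n) - f (k m n)| <= d / 3.
  apply: le_trans (blin_dist _ _ bf) _; apply: Md' => //.
  exact: le_trans ((kP m).2 n) em.
have h2 : `|f (y m) - f (l)| <= d / 3.
  by apply: le_trans (blin_dist _ _ bf) _; apply: Md'.
have -> : f (u n) - f (l) = (f (u n) - f (k m n)) +
  ((f (k m n) - f (y m)) + (f (y m) - f (l))) by ring.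
apply: le_trans (ler_normD _ _) _.
have := ler_normD (f (k m n) - f (y m)) (f (y m) - f (l)).
by lra.
Unshelve. all: by end_near. Qed.

End WeakLimits.

(** * Eberlein-Smulian *)

(** If [A] is not in [F], the trace of [F] on the complement of [A] is proper and extends to an
    ultrafilter that avoids [A]. *)
Lemma ultra_supP T (F : set_system T) (A : set T) : ProperFilter F ->
  (forall V, UltraFilter V -> F `<=` V -> V A) -> F A.
Proof.
move=> FF H; apply: contrapT => nFA.
have GF : ProperFilter (within (~` A) F).
  apply: Build_ProperFilter_ex.
    move=> B WB; apply: contrapT => nB; apply: nFA.
    apply: filterS (WB : F [set t | (~` A) t -> B t]) => t /= AB.
    by apply: contrapT => /AB Bt; apply: nB; exists t.
have [V [VU GV]] := ultraFilterLemma GF.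
have FV : F `<=` V by move=> B FB; apply: GV; rewrite /within /=; apply: filterS FB.
have VA := H V VU FV.
have VnA : V (~` A) by apply: GV; rewrite /within /=; apply: filterE.
have : V (A `&` ~` A) by exact: filterI.
by move=> /filter_ex[t []].
Qed.

Section Separable.
Context {R : realType} {E : completeNormedModType R}.
Implicit Types (f : E -> R) (M : R) (x y : E) (W : set E) (u v e : nat -> E).

Lemma closure_normP W x :
  closure W x <-> forall d : R, 0 < d -> exists2 w, W w & `|x - w| < d.
Proof.
split=> [cx d d0|H B /nbhs_ballP[d /= d0 dB]].
  have [w [Ww]] := cx _ (nbhsx_ballx x d d0).
  by rewrite -ball_normE => xw; exists w.
have [w Ww xw] := H d d0; exists w; split=> //; apply: dB.
by rewrite -ball_normE.
Qed.

Definition rat_comb e (s : seq (rat * nat)) : E := \sum_(p <- s) ratr p.1 *: e p.2.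

(* The closed linear span of e, presented as the closure of a countable set. *)
Definition rspan e : set E := closure (range (rat_comb e)).

Lemma rspan_gen e n : rspan e (e n).
Proof.
apply: subset_closure; exists [:: (1, n)] => //.
by rewrite /rat_comb big_seq1 rmorph1 scale1r.
Qed.

Lemma rspanD e x y : rspan e x -> rspan e y -> rspan e (x + y).
Proof.
move=> /closure_normP ex /closure_normP ey; apply/closure_normP => d d0.
have d2 : 0 < d / 2 by rewrite divr_gt0.
have [_ [s _ <-] xs] := ex _ d2; have [_ [r _ <-] yr] := ey _ d2.
exists (rat_comb e (s ++ r)); first by exists (s ++ r).
rewrite /rat_comb big_cat /= opprD addrACA [d]splitr.
by apply: le_lt_trans (ler_normD _ _) _; exact: ltrD.
Qed.

Lemma rspanZ e (t : R) x : rspan e x -> rspan e (t *: x).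
Proof.
move=> /closure_normP ex; apply/closure_normP => d d0.
have x1 : 0 < `|x| + 1 by rewrite ltr_wpDl.
have d1 : 0 < d / 2 / (`|x| + 1) by rewrite !divr_gt0.
have [q _ qt] : exists2 q : rat, True & `|t - ratr q| < d / 2 / (`|x| + 1).
  have [|q] := @rat_in_itvoo R t (t + d / 2 / (`|x| + 1)); first by rewrite ltrDl.
  rewrite in_itv /= => /andP[h1 h2]; exists q => //.
  by rewrite distrC gtr0_norm ?subr_gt0 // ltrBlDl.
have q1 : 0 < `|ratr q : R| + 1 by rewrite ltr_wpDl.
have d2 : 0 < d / 2 / (`|ratr q : R| + 1) by rewrite !divr_gt0.
have [_ [s _ <-] xs] := ex _ d2.
pose s' := [seq (q * p.1, p.2) | p <- s].
exists (rat_comb e s'); first by exists s'.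
have -> : rat_comb e s' = ratr q *: rat_comb e s.
  rewrite /rat_comb big_map scaler_sumr; apply: eq_bigr => p _.
  by rewrite rmorphM scalerA.
have -> : t *: x - ratr q *: rat_comb e s =
    (t - ratr q) *: x + ratr q *: (x - rat_comb e s).
  by rewrite scalerBl scalerBr addrA subrK.
have h1 : `|(t - ratr q) *: x| <= `|t - ratr q| * (`|x| + 1).
  by rewrite normrZ ler_wpM2l // lerDl.
have h2 : `|ratr q *: (x - rat_comb e s)| <= (`|ratr q : R| + 1) * `|x - rat_comb e s|.
  by rewrite normrZ; apply: ler_wpM2r => //; rewrite lerDl.
rewrite ltr_pdivlMr // in qt; rewrite ltr_pdivlMr // mulrC in xs.
rewrite [d]splitr; apply: le_lt_trans (ler_normD _ _) _.
by apply: ltrD; [exact: le_lt_trans h1 qt|exact: le_lt_trans h2 xs].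
Qed.

Lemma rspanB e x y : rspan e x -> rspan e y -> rspan e (x - y).
Proof. by move=> ex ey; rewrite -scaleN1r; apply: rspanD => //; exact: rspanZ. Qed.

Lemma rspan_closed e : closed (rspan e). Proof. exact: closed_closure. Qed.

Lemma rspan_convex e : convex (rspan e).
Proof. by move=> x y t _ ex ey; apply: rspanD; exact: rspanZ. Qed.

Lemma wlim_rspan T (F : set_system T) {FF : ProperFilter F} e (u : T -> E) x :
  wlim F u x -> (forall t, rspan e (u t)) -> rspan e x.
Proof.
move=> ux eu; apply: (mazur (@rspan_closed e) (@rspan_convex e) _ ux); exact: filterE.
Qed.

(** The functionals norm the rational combinations, which are dense in [rspan e]. If all of them
    vanish at [x - y], a combination close to [x - y] has small norm, and so has [x - y]. *)
Lemma separating_family e : exists f : nat -> E -> R,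
  (forall k, blin 1 (f k)) /\
  forall x y, rspan e x -> rspan e y -> (forall k, f k x = f k y) -> x = y.
Proof.
pose r k := rat_comb e (odflt [::] (unpickle k)).
have /choice[f fP] : forall k, exists f, blin 1 f /\ f (r k) = `|r k|.
  by move=> k; exact: norming_functional.
exists f; split=> [k|x y ex ey fxy]; first exact: (fP k).1.
apply/eqP; rewrite -subr_eq0 -normr_le0; apply/ler_addgt0Pl => d d0.
rewrite addr0; have d2 : 0 < d / 2 by rewrite divr_gt0.
have /closure_normP /(_ _ d2)[_ [s _ <-] xs] := rspanB ex ey.
have [bf fr] := fP (pickle s); rewrite /r pickleK /= in fr.
have : `|rat_comb e s| <= d / 2.
  rewrite -fr; have -> : f (pickle s) (rat_comb e s) =
      f (pickle s) (rat_comb e s) - f (pickle s) (x - y).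
    by rewrite (linear_formB x y bf.1) fxy subrr subr0.
  apply: le_trans (ler_norm _) _; apply: le_trans (blin_dist _ _ bf) _.
  by rewrite mul1r distrC ltW.
have := ler_normD (x - y - rat_comb e s) (rat_comb e s).
rewrite subrK; lra.
Qed.

(* Eberlein-Smulian and the angelic property in one statement: relatively weakly
   compact sequences have metrizable weak closures.  The indices t n are not
   increasing in general. *)
Lemma relwcs_subsequence (u : nat -> nat -> E) (x : nat -> E)
    (U : set_system nat) (Z : set nat) : UltraFilter U ->
  (forall i, relwcs (u i)) -> (forall i, wlim U (u i) (x i)) -> U Z ->
  exists t : nat -> nat, (forall n, Z (t n)) /\
    forall i, wlim \oo (u i \o t) (x i).
Proof.
move=> UU uc ux UZ.
(* All terms of all the sequences are listed together, so that one countable separating family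
   serves every [u i]. *)
pose e n := let p := odflt (0, 0)%N (unpickle n) in u p.1 p.2.
have eu i t : rspan e (u i t).
  by have := @rspan_gen e (pickle (i, t)); rewrite /e pickleK.
have [f [bf fsep]] := separating_family e.
have /choice[t tP] : forall n, exists t, Z t /\
    forall k i : 'I_n.+1, `|f k (u i t) - f k (x i)| < n.+1%:R^-1.
  move=> n; have e0 : (0 : R) < n.+1%:R^-1 by rewrite invr_gt0 ltr0n.
  have Uf : U [set t | forall k i : 'I_n.+1, `|f k (u i t) - f k (x i)| < n.+1%:R^-1].
    apply: filter_forall => k; apply: filter_forall => i.
    exact: cvg_dist (ux i _ _ (bf k)) e0.
  have : U (Z `&` [set t | forall k i : 'I_n.+1,
      `|f k (u i t) - f k (x i)| < n.+1%:R^-1]) by exact: filterI.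
  by move=> /filter_ex[s [Zs fs]]; exists s.
exists t; split=> [n|i]; first exact: (tP n).1.
have fcvg k : f k (u i (t n)) @[n --> \oo] --> f k (x i).
  apply/cvgrPdistC_le => d d0; near=> n.
  have kn : (k < n.+1)%N by rewrite ltnS; near: n; exists k.
  have jn : (i < n.+1)%N by rewrite ltnS; near: n; exists i.
  have := (tP n).2 (Ordinal kn) (Ordinal jn) => /= /ltW /le_trans; apply.
  by apply: ltW; near: n; exact: near_harmonic.
move=> M g bg; apply/cvgrPdistC_le => d d0.
(* Along any finer ultrafilter [u i \o t] has some weak limit [z]. Both [z] and [x i] lie in
   [rspan e] and the family [f] does not distinguish them. *)
apply: ultra_supP => V VU oV.
have [z uz] := relwcs_comp t (uc i) VU.
have -> : x i = z.
  apply: fsep; [exact: wlim_rspan (ux i) (eu i)|exact: wlim_rspan uz (fun n => eu i (t n))|move=> k].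
  apply: (@cvg_unique _ (@norm_hausdorff _ R^o) (f k (u i (t n)) @[n --> V])).
    by move=> A /fcvg; exact: oV.
  exact: uz _ _ (bf k).
have uzd : V [set n | `|g (u i (t n)) - g z| < d] by exact: cvg_dist (uz _ _ bg) d0.
by apply: filterS uzd => n /ltW.
Unshelve. all: by end_near. Qed.

End Separable.

(** * Krein-Smulian *)

Section BlinAlgebra.
Context {R : realType} {E : completeNormedModType R}.
Implicit Types (f g : E -> R) (M N a : R) (x y : E).

Lemma blinD M N f g : blin M f -> blin N g -> blin (M + N) (fun x => f x + g x).
Proof.
move=> [lf fM] [lg gN]; split=> [|x].
  by split=> [x y|a x]; [rewrite lf.1 lg.1 addrACA|rewrite lf.2 lg.2 mulrDr].
by rewrite mulrDl; apply: le_trans (ler_normD _ _) _; exact: lerD.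
Qed.

Lemma blinZ M f a : blin M f -> blin (`|a| * M) (fun x => a * f x).
Proof.
move=> [lf fM]; split=> [|x].
  by split=> [x y|b x]; [rewrite lf.1 mulrDr|rewrite lf.2 mulrCA].
by rewrite normrM -mulrA ler_wpM2l.
Qed.

Lemma blin_le M N f : M <= N -> blin M f -> blin N f.
Proof.
by move=> MN [lf fM]; split=> // x; apply: le_trans (fM x) _; rewrite ler_wpM2r.
Qed.

Lemma blin0 : blin 0 (fun _ : E => 0 : R).
Proof.
by split=> [|x]; [split=> *; rewrite ?addr0 ?mulr0|rewrite normr0 mul0r].
Qed.

(* Hahn-Banach on R^m; in the second alternative x represents L up to d, since f
   may be replaced by -f. *)
Lemma helly_dichotomy (L : (E -> R) -> R) m (k : 'I_m -> E) (d eta : R) :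
  0 < d -> 0 < eta ->
  (forall M N f g, blin M f -> blin N g -> L (fun x => f x + g x) = L f + L g) ->
  (forall M f a, blin M f -> L (fun x => a * f x) = a * L f) ->
  (exists f, [/\ blin 1 f, forall i, `|f (k i)| <= eta & d <= L f]) \/
  (exists x, forall f, blin 1 f -> L f - f x <= d).
Proof.
move=> d0 eta0 LD LZ.
have [[f fP]|nf] := pselect (exists f, [/\ blin 1 f,
    forall i, `|f (k i)| <= eta & d <= L f]); [by left; exists f|right].
pose C := d / eta.
have C0 : 0 <= C by rewrite /C divr_ge0 // ltW.
(* If this failed for [f], then [s^-1 * f] would realize the first alternative. The slack [t] keeps
   [s] positive. *)
have Lle B f : 0 <= B -> blin B f -> L f <= d * B + C * \sum_i `|f (k i)|.
  move=> B0 bf; apply/ler_addgt0Pr => t t0.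
  set S := \sum_i _; have S0 : 0 <= S by apply: sumr_ge0.
  pose s := B + S / eta + t / d.
  have s0 : 0 < s.
    by rewrite /s ltr_wpDl ?divr_gt0 // addr_ge0 // divr_ge0 // ltW.
  have sI : 0 <= s^-1 by rewrite invr_ge0 ltW.
  have ds : d * B + C * S + t = d * s.
    by rewrite /s /C; field; rewrite !gt_eqF.
  rewrite ds -ler_pdivrMr // mulrC -(LZ B) //; apply/ltW.
  rewrite ltNge; apply/negP => dL; apply: nf; exists (fun x => s^-1 * f x).
  split=> // [|i].
    apply: blin_le (blinZ s^-1 bf); rewrite ger0_norm // mulrC ler_pdivrMr // mul1r.
    by rewrite /s -addrA lerDl addr_ge0 // divr_ge0 // ltW.
  rewrite normrM ger0_norm // mulrC ler_pdivrMr // -ler_pdivrMl //.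
  apply: le_trans (_ : S / eta <= _); last first.
    by rewrite /s addrAC lerDr addr_ge0 // divr_ge0 // ltW.
  rewrite mulrC; apply: ler_wpM2r; first by rewrite invr_ge0 ltW.
  by rewrite /S (bigD1 i) //= lerDl sumr_ge0.
pose P (s : 'rV[R]_m) := [set z | exists B f, [/\ 0 <= B, blin B f &
  z = d * B + C * \sum_i `|s 0 i + f (k i)| - L f]].
pose q s := inf (P s).
pose v (s : 'rV[R]_m) B f := d * B + C * \sum_i `|s 0 i + f (k i)| - L f.
have Pge (s : 'rV[R]_m) B f : 0 <= B -> blin B f -> - (C * \sum_i `|s 0 i|) <= v s B f.
  move=> B0 bf; have := Lle B f B0 bf; rewrite /v.
  have : C * \sum_i `|f (k i)| <=
      C * \sum_i `|s 0 i + f (k i)| + C * \sum_i `|s 0 i|.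
    rewrite -mulrDr ler_wpM2l // -big_split /=; apply: ler_sum => i _.
    have := ler_normB (s 0 i + f (k i)) (s 0 i).
    by rewrite addrAC subrr add0r.
  lra.
have qle (s : 'rV[R]_m) B f : 0 <= B -> blin B f -> q s <= v s B f.
  move=> B0 bf; apply: (@inf_lower _ _ (- (C * \sum_i `|s 0 i|))); last by exists B, f.
  by move=> _ [B' [f' [B'0 bf' ->]]]; exact: Pge.
have leq_ (s : 'rV[R]_m) z : (forall B f, 0 <= B -> blin B f -> z <= v s B f) -> z <= q s.
  move=> H; apply: le_inf_of; last by move=> _ [B [f [B0 bf ->]]]; exact: H.
  by exists (v s 0 (fun=> 0)), 0, (fun=> 0); split => //; exact: blin0.
have sq : sublinear q.
  split=> [s r|a s].
    rewrite -lerBlDr; apply: (leq_) => B f B0 bf; rewrite lerBlDr -lerBlDl.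
    apply: (leq_) => B' f' B'0 bf'; rewrite lerBlDl.
    apply: le_trans (qle _ _ _ (addr_ge0 B0 B'0) (blinD bf bf')) _.
    rewrite /v (LD _ _ _ _ bf bf').
    have : C * \sum_i `|(s + r) 0 i + (f (k i) + f' (k i))| <=
        C * \sum_i `|s 0 i + f (k i)| + C * \sum_i `|r 0 i + f' (k i)|.
      rewrite -mulrDr ler_wpM2l // -big_split /=; apply: ler_sum => i _.
      by rewrite mxE addrACA; exact: ler_normD.
    lra.
  have q0 : q 0 <= 0.
    apply: le_trans (qle _ _ _ (lexx 0) blin0) _; rewrite /v.
    rewrite big1 => [|i _]; last by rewrite mxE addr0 normr0.
    have -> : L (fun=> 0) = 0.
      by have := LZ _ (fun=> 0) 0 blin0; rewrite (mul0r (L _)) mulr0.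
    by rewrite !mulr0 subr0 addr0.
  rewrite le_eqVlt => /predU1P[<-|a0]; first by rewrite scale0r mul0r.
  rewrite -ler_pdivrMl //; apply: (leq_) => B f B0 bf; rewrite ler_pdivrMl //.
  have aB : 0 <= `|a| * B by rewrite mulr_ge0.
  apply: le_trans (qle _ _ _ aB (blinZ a bf)) _.
  rewrite /v (LZ _ _ _ bf) gtr0_norm //.
  have -> : \sum_i `|(a *: s) 0 i + a * f (k i)| = a * \sum_i `|s 0 i + f (k i)|.
    rewrite mulr_sumr; apply: eq_bigr => i _.
    by rewrite mxE -mulrDr normrM gtr0_norm.
  by rewrite le_eqVlt; apply/orP; left; apply/eqP; ring.
have [l [ll lq]] := sublinear_dominates_linear sq.
(* At the vector of the [- f (k i)], with [B = 1], the sum in the definition of [q] vanishes and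
   [l <= q] reads [- f x <= d - L f]. *)
exists (\sum_i l (delta_mx 0 i) *: k i) => f bf.
pose s : 'rV[R]_m := \row_i (- f (k i)).
have ls : l s = - f (\sum_i l (delta_mx 0 i) *: k i).
  rewrite [s]row_sum_delta (linear_form_sum _ _ _ ll) (linear_form_sum _ _ _ bf.1).
  rewrite -sumrN; apply: eq_bigr => i _.
  by rewrite ll.2 bf.1.2 /s mxE mulNr mulrC.
have := le_trans (lq s) (qle s 1 f ler01 bf).
rewrite ls /v [X in C * X]big1 => [|i _]; last by rewrite /s mxE addNr normr0.
by rewrite mulr1 mulr0; lra.
Qed.

End BlinAlgebra.

(** * Barycenters of means on a relatively weakly compact sequence *)

Section Barycenter.
Context {R : realType} {E : completeNormedModType R}.
Implicit Types (f : E -> R) (g h : nat -> R) (M N a b c : R) (x y : E).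

Definition bounded_seq g : Prop := exists c, forall n, `|g n| <= c.

Lemma bounded_seqD g h : bounded_seq g -> bounded_seq h ->
  bounded_seq (fun n => g n + h n).
Proof.
move=> [c gc] [d hd]; exists (c + d) => n.
by apply: le_trans (ler_normD _ _) _; exact: lerD.
Qed.

Lemma bounded_seqZ g a : bounded_seq g -> bounded_seq (fun n => a * g n).
Proof.
by move=> [c gc]; exists (`|a| * c) => n; rewrite normrM ler_wpM2l.
Qed.

Lemma bounded_seq_cst c : bounded_seq (fun=> c).
Proof. by exists `|c|. Qed.

(** Finitely additive probabilities on [nat], seen as integrals. The laws concern bounded sequences
    because an ultrafilter limit of means is only determined there. *)
Record is_mean (lam : (nat -> R) -> R) : Prop := {
  meanD : forall g h, bounded_seq g -> bounded_seq h ->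
    lam (fun n => g n + h n) = lam g + lam h;
  meanZ : forall a g, bounded_seq g -> lam (fun n => a * g n) = a * lam g;
  mean_ge0 : forall g, bounded_seq g -> (forall n, 0 <= g n) -> 0 <= lam g;
  mean1 : lam (fun=> 1) = 1 }.

Section MeanTheory.
Variables (lam : (nat -> R) -> R) (lamP : is_mean lam).

Lemma mean_cst c : lam (fun=> c) = c.
Proof.
have -> : (fun=> c) = (fun _ : nat => c * 1) by apply/funext => n; rewrite mulr1.
by rewrite (meanZ lamP) ?(mean1 lamP) ?mulr1 //; exact: bounded_seq_cst.
Qed.

Lemma mean_le g h : bounded_seq g -> bounded_seq h ->
  (forall n, g n <= h n) -> lam g <= lam h.
Proof.
move=> bg bh gh.
have bgh : bounded_seq (fun n => h n + -1 * g n).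
  by apply: bounded_seqD => //; exact: bounded_seqZ.
have := mean_ge0 lamP bgh; rewrite (meanD lamP) //; last exact: bounded_seqZ.
rewrite (meanZ lamP) // => H; have : 0 <= lam h + -1 * lam g.
  by apply: H => n; have := gh n; lra.
lra.
Qed.

Lemma mean_norm_le g c : (forall n, `|g n| <= c) -> `|lam g| <= c.
Proof.
move=> gc; have bg : bounded_seq g by exists c.
have gl n : - c <= g n by have := gc n; rewrite ler_norml => /andP[].
have gr n : g n <= c by have := gc n; rewrite ler_norml => /andP[].
have := mean_le (bounded_seq_cst (- c)) bg gl.
have := mean_le bg (bounded_seq_cst c) gr.
by rewrite !mean_cst ler_norml => -> ->.
Qed.

End MeanTheory.

Variables (k : nat -> E) (M : R).
Hypotheses (kc : relwcs k) (kM : forall n, `|k n| <= M).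
Variables (lam : (nat -> R) -> R) (lamP : is_mean lam).

Let bounded_f B f : blin B f -> bounded_seq (f \o k).
Proof.
move=> [_ fB]; exists (`|B| * M) => n; apply: le_trans (fB _) _.
apply: le_trans (_ : `|B| * `|k n| <= _); first by rewrite ler_wpM2r // ler_norm.
by rewrite ler_wpM2l.
Qed.

(* No sequence of functionals converging to 0 on the weak closure of k stays
   above d > 0 in mean: this is Luxemburg's elementary proof of the bounded
   convergence theorem, with Dini's theorem on the weak closure. *)
Lemma no_mean_escape (f : nat -> E -> R) (d : R) : 0 < d ->
  (forall m, blin 1 (f m)) -> (forall m, d <= lam (f m \o k)) ->
  ~ (forall U x, UltraFilter U -> wlim U k x -> f m x @[m --> \oo] --> 0).
Proof.
move=> d0 bf fd f0.
have M0 : 0 <= M by apply: le_trans (kM 0).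
(* The last clause says that [phi] lies below the supremum of the [|f m|] with [m >= n], without
   writing that supremum; the first is weak continuity along [k]. *)
pose dom n (phi : E -> R) := [/\ forall U x, UltraFilter U -> wlim U k x ->
    phi (k i) @[i --> U] --> phi x, forall y, 0 <= phi y &
    forall y b, (forall m, (n <= m)%N -> `|f m y| <= b) -> phi y <= b].
have fkM m i : `|f m (k i)| <= M.
  by apply: le_trans ((bf m).2 _) _; rewrite mul1r.
have dom_bd n phi i : dom n phi -> `|phi (k i)| <= M.
  move=> [_ phi0 phib]; rewrite ger0_norm //; apply: phib => m _; exact: fkM.
have dom_bs n phi : dom n phi -> bounded_seq (phi \o k).
  by move=> dphi; exists M => i; apply: dom_bd dphi.
have domf n : dom n (fun y => `|f n y|).
  split=> [U x UU kx|y|y b ->//].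
  - by apply: (@cvg_norm R R); exact: kx _ _ (bf n).
  - exact: normr_ge0.
have domS n phi : dom n.+1 phi -> dom n phi.
  move=> [h1 h2 h3]; split=> // y b H; apply: h3 => m nm; apply: H; exact: ltnW.
have dom_max n phi psi : dom n phi -> dom n psi ->
    dom n (fun y => Num.max (phi y) (psi y)).
  move=> [p1 p2 p3] [q1 q2 q3]; split=> [U x UU kx|y|y b H].
  - by apply: cvg_maxr; [exact: p1|exact: q1].
  - by rewrite le_max p2.
  - by rewrite ge_max p3 // q3.
have dom_min n phi psi : dom n psi -> (exists n', dom n' phi) ->
    dom n (fun y => Num.min (phi y) (psi y)).
  move=> [q1 q2 q3] [n' [p1 p2 p3]]; split=> [U x UU kx|y|y b H].
  - by apply: cvg_minr; [exact: p1|exact: q1].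
  - by rewrite le_min p2 q2.
  - by rewrite ge_min q3 // orbT.
pose I n := sup [set lam (phi \o k) | phi in dom n].
have le_I n phi : dom n phi -> lam (phi \o k) <= I n.
  move=> dphi; apply: ub_le_sup; last by exists phi.
  exists M => _ [psi dpsi <-]; apply: le_trans (ler_norm _) _.
  by apply: mean_norm_le => // i; apply: dom_bd dpsi.
(* The errors [del 0], ..., [del n] add up to [d / 2 - del n], the loss allowed in [lamH]. *)
pose del n : R := d / 2 * 2^-1 ^+ n.+1.
have del0 n : 0 < del n by rewrite /del mulr_gt0 ?exprn_gt0 ?divr_gt0.
have delS n : del n = 2 * del n.+1.
  by rewrite /del [X in 2 * (_ * X)]exprS; field.
have /choice[h hP] : forall n, exists phi, dom n phi /\ I n - del n < lam (phi \o k).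
  move=> n; have supI : has_sup [set lam (phi \o k) | phi in dom n].
    split; first by exists (lam ((fun y => `|f n y|) \o k)); exists (fun y => `|f n y|).
    exists M => _ [psi dpsi <-]; apply: le_trans (ler_norm _) _.
    by apply: mean_norm_le => // i; apply: dom_bd dpsi.
  by have [_ [phi dphi <-] lt] := sup_adherent (del0 n) supI; exists phi.
pose H := fix H n : E -> R := if n is n'.+1
  then fun y => Num.min (H n' y) (h n y) else h 0.
have domH n : dom n (H n).
  elim: n => [|n IH]; first exact: (hP 0).1.
  by apply: dom_min; [exact: (hP n.+1).1|exists n].
have lamH n : I n - d / 2 + del n <= lam (H n \o k).
  elim: n => [|n IH].
    have := (hP 0).2; have : del 0 = d / 4 by rewrite /del expr1; field.
    by rewrite /=; lra.
  have dmax : dom n (fun y => Num.max (H n y) (h n.+1 y)).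
    by apply: dom_max => //; apply: domS; exact: (hP n.+1).1.
  have := le_I _ _ dmax.
  have dh := (hP n.+1).1.
  have bsH := dom_bs _ _ (domH n); have bsh := dom_bs _ _ dh.
  (* Minimum plus maximum equals the sum, and the maximum has mean at most [I n]; so the gap between
     [I] and the mean of [H] grows by at most [del n.+1]. *)
  have : lam (H n.+1 \o k) + lam ((fun y => Num.max (H n y) (h n.+1 y)) \o k) =
      lam (H n \o k) + lam (h n.+1 \o k).
    rewrite -!(meanD lamP) //; [|exact: dom_bs (domH n.+1)|exact: dom_bs dmax].
    by congr lam; apply/funext => i /=; rewrite addr_min_max.
  have := (hP n.+1).2; have := delS n; lra.
(* Dini's argument: otherwise points with [H n > d / 4] accumulate weakly at some [x], where
   monotonicity gives [H m x >= d / 4] for all [m], although [f m x] tends to 0. *)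
have [n Hn] : exists n, forall i, H n (k i) <= d / 4.
  apply: contrapT => nH.
  have /choice[s sP] : forall n, exists i, d / 4 < H n (k i).
    move=> n; apply: contrapT => ni; apply: nH; exists n => i; rewrite leNgt.
    by apply/negP => Hi; apply: ni; exists i.
  have [U [UU oU]] := free_ultrafilter.
  have [x kx] := relwcs_comp s kc UU.
  have xU : wlim (s @ U) k x by [].
  have sU : UltraFilter (s @ U) := ultra_fmap s UU.
  have Hmono m n' y : (m <= n')%N -> H n' y <= H m y.
    elim: n' => [|n' IH]; first by rewrite leqn0 => /eqP ->.
    rewrite leq_eqVlt => /predU1P[-> //|]; rewrite ltnS => mn.
    by apply: le_trans (IH mn); rewrite /= ge_min lexx.
  have Hx m : d / 4 <= H m x.
    have [Hc _ _] := domH m.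
    apply: (@cvg_ge_bound _ _ U _ (fun n => H m (k (s n)))); first exact: Hc xU.
    apply: oU; exists m => // n' /= mn; apply: le_trans (Hmono m n' _ mn).
    exact: ltW.
  have := f0 _ _ sU xU => /cvgrPdistC_le /(_ (d / 8)) [|N _ NP].
    by rewrite divr_gt0.
  have [_ _ /(_ x (d / 8))] := domH N.
  have := Hx N => h1 h2; have : H N x <= d / 8.
    by apply: h2 => m Nm; have := NP m Nm; rewrite /= subr0.
  lra.
have := lamH n; have : lam (H n \o k) <= d / 4.
  rewrite -[X in _ <= X](mean_cst lamP); apply: mean_le => //.
    exact: dom_bs (domH n).
  exact: bounded_seq_cst.
have := del0 n; have : d <= I n.
  apply: le_trans (le_I _ _ (domf n)); apply: le_trans (fd n) _.
  apply: mean_le => //; [exact: bounded_f (bf n)|exact: dom_bs (domf n)|].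
  by move=> i; rewrite /= ler_norm.
lra.
Qed.

(* Krein-Smulian: convex combinations of the k n, and their limits, are means. *)
Theorem mean_barycenter : exists x, forall B f, blin B f -> lam (f \o k) = f x.
Proof.
pose L f := lam (f \o k).
have LD B B' f f' : blin B f -> blin B' f' -> L (fun x => f x + f' x) = L f + L f'.
  by move=> bf bf'; rewrite /L -(meanD lamP (bounded_f bf) (bounded_f bf')).
have LZ B f a : blin B f -> L (fun x => a * f x) = a * L f.
  by move=> bf; rewrite /L -(meanZ lamP _ (bounded_f bf)).
have reduce x : (forall f, blin 1 f -> L f = f x) -> forall B f, blin B f -> L f = f x.
  move=> H B f bf; pose c : R := `|B| + 1; have c0 : 0 < c by rewrite ltr_wpDl.
  have b1 : blin 1 (fun y => c^-1 * f y).
    apply: blin_le (blinZ c^-1 bf); rewrite gtr0_norm ?invr_gt0 // mulrC.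
    by rewrite ler_pdivrMr // mul1r /c; have := ler_norm B; lra.
  have cI : c^-1 != 0 by rewrite invr_eq0 gt_eqF.
  by apply: (mulfI cI); rewrite -(LZ B) //; exact: H.
have Nbl f : blin 1 f -> blin 1 (fun y => -1 * f y).
  by move=> bf; apply: blin_le (blinZ (-1) bf); rewrite normrN1 mulr1.
apply: contrapT => nx.
(* If [L] were represented by points up to every [d], these points would form a Cauchy sequence and
   its limit would represent [L] exactly. *)
have [d d0 dP] : exists2 d : R, 0 < d & forall x, exists2 f, blin 1 f & d < L f - f x.
  apply: contrapT => nd; apply: nx.
  have apx (d : R) : 0 < d -> exists x, forall f, blin 1 f -> `|L f - f x| <= d.
    move=> d0; apply: contrapT => nx; apply: nd; exists d => // x.
    apply: contrapT => nf; apply: nx; exists x => f bf.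
    have le (g : E -> R) : blin 1 g -> L g - g x <= d.
      by move=> bg; rewrite leNgt; apply/negP => lt; apply: nf; exists g.
    rewrite ler_norml; have := le _ bf; have := le _ (Nbl _ bf).
    by rewrite (LZ _ _ _ bf) => h1 h2; apply/andP; split; lra.
  have /choice[y yP] : forall m, exists x, forall f, blin 1 f -> `|L f - f x| <= m.+1%:R^-1.
    by move=> m; apply: apx; rewrite invr_gt0 ltr0n.
  have [m n|x yx] := @harmonic_cauchy R E y.
    have [f [bf <-]] := norming_functional (y m - y n).
    rewrite (linear_formB _ _ bf.1); apply: le_trans (ler_norm _) _.
    have := yP m f bf; have := yP n f bf; move=> h1 h2.
    have -> : f (y m) - f (y n) = - (L f - f (y m)) + (L f - f (y n)) by ring.
    by apply: le_trans (ler_normD _ _) _; rewrite normrN lerD.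
  exists x; apply: reduce => f bf; apply/eqP; rewrite -subr_eq0 -normr_le0.
  apply/ler_addgt0Pl => e e0; rewrite addr0; have e2 : 0 < e / 2 by rewrite divr_gt0.
  have : \forall m \near \oo, (m.+1%:R^-1 : R) < e / 2 /\ `|y m - x| < e / 2.
    move/cvgrPdistC_lt: yx => /(_ _ e2) yx.
    by near=> m; split; near: m; [exact: near_harmonic|exact: yx].
  move=> /filter_ex[m [h1 h2]].
  have -> : L f - f x = (L f - f (y m)) + (f (y m) - f x) by ring.
  apply: le_trans (ler_normD _ _) _; rewrite [e]splitr; apply: lerD.
    by apply: le_trans (yP m f bf) _; exact: ltW.
  by apply: le_trans (blin_dist _ _ bf) _; rewrite mul1r ltW.
have /choice[f fP] : forall m, exists f,
    [/\ blin 1 f, forall i : 'I_m, `|f (k i)| <= m.+1%:R^-1 & d <= L f].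
  move=> m; have e0 : (0 : R) < m.+1%:R^-1 by rewrite invr_gt0 ltr0n.
  have [//|[x xP]] := helly_dichotomy (fun i : 'I_m => k i) d0 e0 LD LZ.
  by have [f bf df] := dP x; have := xP f bf; rewrite leNgt df.
apply: (@no_mean_escape f d d0) => [m|m|U x UU kx]; [by have [] := fP m|by have [] := fP m|].
(* [W] is closed and convex and contains every [k i], since [f m] is small on the first [m] terms;
   by Mazur it contains the weak limits of [k]. *)
pose W := [set y | f m y @[m --> \oo] --> (0 : R)].
have bf m : blin 1 (f m) by have [] := fP m.
apply: (@mazur _ _ _ U _ k x W _ _ _ kx).
- move=> y /closure_normP yW; apply/cvgrPdistC_le => e e0.
  have e2 : 0 < e / 2 by rewrite divr_gt0.
  have [w Ww yw] := yW _ e2.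
  move/cvgrPdistC_le: Ww => /(_ _ e2); apply: filterS => m; rewrite !subr0 => fw.
  have -> : f m y = (f m y - f m w) + f m w by ring.
  apply: le_trans (ler_normD _ _) _; rewrite [e]splitr; apply: lerD => //.
  by apply: le_trans (blin_dist _ _ (bf m)) _; rewrite mul1r ltW.
- move=> y z t _ Wy Wz; rewrite /W /=.
  have : t * f m y + (1 - t) * f m z @[m --> \oo] --> t * 0 + (1 - t) * 0.
    by apply: cvgD; apply: cvgM => //; exact: cvg_cst.
  rewrite !mulr0 addr0 (_ : (fun m => t * f m y + (1 - t) * f m z) =
    fun m => f m (t *: y + (1 - t) *: z)) //.
  by apply/funext => m; rewrite (bf _).1.1 !(bf _).1.2.
- apply: filterE => i; apply/cvgrPdistC_le => e e0; near=> m; rewrite subr0.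
  have im : (i < m)%N by near: m; exists i.+1.
  have [_ /(_ (Ordinal im)) /= h _] := fP m.
  by apply: le_trans h _; apply: ltW; near: m; exact: near_harmonic.
Unshelve. all: by end_near. Qed.

End Barycenter.

(** * Approximate fixed points *)

Section ApproximateFixedPoint.
Context {R : realType} {E : completeNormedModType R}.
Implicit Types (f g : E -> R) (M a b c : R) (x y : E) (V : set E).

Definition average m (y : 'I_m -> E) : E := m%:R^-1 *: \sum_i y i.

Definition average_closed V : Prop :=
  forall m (y : 'I_m -> E), (0 < m)%N -> (forall i, V (y i)) -> V (average y).

Lemma blin_average f m (I : finType) (y : I -> E) (x : {ffun 'I_m -> I}) M :
  blin M f ->
  f (average (fun s => y (x s))) = m%:R^-1 * \sum_i (occ i x)%:R * f (y i).
Proof.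
move=> [lf _]; rewrite lf.2 (linear_form_sum _ _ _ lf); congr (_ * _).
transitivity (\sum_(s < m) \sum_i (x s == i)%:R * f (y i)).
  apply: eq_bigr => s _; rewrite (bigD1 (x s)) //= eqxx mul1r big1 ?addr0 // => i.
  by rewrite eq_sym => /negPf ->; rewrite mul0r.
rewrite exchange_big /=; apply: eq_bigr => i _.
by rewrite -mulr_suml /occ natr_sum.
Qed.

(** A cell records the first [n] values, shifted by [M] to be nonnegative and rounded down to
    multiples of [eps]. *)
Lemma finite_cells (f : nat -> E -> R) n V M eps : 0 < eps ->
  (forall k x, V x -> `|f k x| <= M) ->
  exists (I : finType) (cell : E -> I), forall x y, V x -> V y ->
    cell x = cell y -> forall k, (k < n)%N -> `|f k x - f k y| <= eps.
Proof.
move=> eps0 fM.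
pose slot k x := Num.truncn ((f k x + M) / eps).
pose B := Num.truncn ((M + M) / eps).
exists {ffun 'I_n -> 'I_B.+1}.
exists (fun x => [ffun k : 'I_n => inord (slot k x)]) => x y Vx Vy xy k kn.
have sl z : V z -> 0 <= (f k z + M) / eps /\ (slot k z < B.+1)%N.
  move=> Vz; have := fM k z Vz; rewrite ler_norml => /andP[h1 h2].
  split; first by apply: divr_ge0; [lra|exact: ltW].
  by rewrite ltnS; apply: le_truncn; rewrite ler_pM2r ?invr_gt0 //; lra.
have [x0 xB] := sl x Vx; have [y0 yB] := sl y Vy.
move/ffunP: xy => /(_ (Ordinal kn)); rewrite !ffunE => /(congr1 val).
rewrite /= !inordK // => sxy.
have := truncn_itv x0; have := truncn_itv y0; rewrite -/(slot k x) -/(slot k y) sxy.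
move=> /andP[h1 h2] /andP[h3 h4].
have e1 : (slot k y).+1%:R = (slot k y)%:R + 1 :> R by rewrite -natr1.
rewrite e1 in h2 h4.
have : `|(f k x + M) / eps - (f k y + M) / eps| <= 1.
  by rewrite ler_norml; apply/andP; split; lra.
rewrite -mulrBl opprD addrACA subrr addr0 normrM normfV (gtr0_norm eps0).
by rewrite ler_pdivrMr // mul1r.
Qed.

(** The point [x] precedes [g], while [z] may depend on it: this is the dual way of saying that [x]
    is almost an average of values [h z] at nearby [z]. Grid points are sent to averages of the
    values of [h] at representatives of the cells, and coloured by the cell they fall in. *)
Lemma approximate_fixed_point V (h : E -> E) M (f : nat -> E -> R) n eps :
  V !=set0 -> (forall x, V x -> `|x| <= M) -> (forall x, V x -> V (h x)) ->
  average_closed V -> (forall k, blin 1 (f k)) -> 0 < eps ->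
  exists x, V x /\ forall g, blin 1 g -> exists z,
    [/\ V z, forall k, (k < n)%N -> `|f k x - f k z| <= eps & g (h z) <= g x + eps].
Proof.
move=> [v0 Vv0] VM hV avV bf eps0.
have M0 : 0 <= M by apply: le_trans (VM _ Vv0).
have blinV g x : blin 1 g -> V x -> `|g x| <= M.
  by move=> bg Vx; apply: le_trans (bg.2 x) _; rewrite mul1r VM.
have eps2 : 0 < eps / 2 by rewrite divr_gt0.
have [I [cell cellP]] := @finite_cells f n V M _ eps2 (fun k x => blinV _ x (bf k)).
have /choice[rep repP] : forall i : I, exists x, V x /\
    ((exists2 w, V w & cell w = i) -> cell x = i).
  move=> i; have [[w Vw wi]|nw] := pselect (exists2 w, V w & cell w = i).
    by exists w.
  by exists v0; split=> // /nw.
pose y i := h (rep i).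
have Vy i : V (y i) by apply: hV; exact: (repP i).1.
pose N : R := #|I|%:R.
have N0 : 0 <= N by rewrite ler0n.
(* The grid is fine enough for the points of [D] to be [eps / 2] close under every functional of
   norm at most 1, and for the total error in the final estimate to stay below the gain
   [(m - N) * eps]. *)
pose m := (Num.truncn (N + 4 * N * M / eps)).+1.
have m_big : N + 4 * N * M / eps < m%:R.
  by apply: real_truncnS_gt; exact: num_real.
have m0 : (0 : R) < m%:R by rewrite ltr0n.
pose pt (x : {ffun 'I_m -> I}) : E := average (fun s => y (x s)).
have Vpt (x : {ffun 'I_m -> I}) : V (pt x) by apply: avV => // s.
have [D [e [/set0Pn[d0 d0D] eD me eC]]] :=
  @grid_dominant I m (cell v0) (fun x : {ffun 'I_m -> I} => cell (pt x)).
exists (pt d0); split=> // g bg; apply: contrapT => nz.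
have me' : m%:R <= \sum_i (e i)%:R + N :> R.
  by rewrite -natr_sum -natrD ler_nat.
pose rest (d : {ffun 'I_m -> I}) i : R := (occ i d)%:R - (e i)%:R.
have rest0 d i : d \in D -> 0 <= rest d i.
  by move=> dD; rewrite subr_ge0 ler_nat eD.
have rest_sum d : \sum_i rest d i <= N.
  by rewrite sumrB -natr_sum sum_occ; lra.
have pt_close d f' : d \in D -> blin 1 f' -> `|f' (pt d) - f' (pt d0)| <= eps / 2.
  move=> dD bf'; rewrite !(blin_average _ _ bf') -mulrBr -sumrB normrM.
  rewrite gtr0_norm ?invr_gt0 // mulrC ler_pdivrMr //.
  apply: le_trans (_ : \sum_i (rest d i + rest d0 i) * M <= _).
    apply: le_trans (ler_norm_sum _ _ _) _; apply: ler_sum => i _.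
    rewrite -mulrBl normrM; apply: ler_pM => //; last exact: blinV.
    have -> : (occ i d)%:R - (occ i d0)%:R = rest d i - rest d0 i :> R.
      by rewrite /rest; ring.
    apply: le_trans (ler_normB _ _) _.
    by rewrite !ger0_norm ?rest0.
  rewrite -mulr_suml big_split /=.
  apply: le_trans (_ : (N + N) * M <= _).
    by apply: ler_wpM2r => //; apply: lerD; exact: rest_sum.
  have : 4 * N * M / eps < m%:R by lra.
  rewrite ltr_pdivrMr //; lra.
(* For each index of positive weight some point of [D] has that colour, so its representative is
   near [pt d0] and would serve as [z] if the inequality failed. *)
have gy i : (0 < e i)%N -> g (pt d0) + eps < g (y i).
  move=> /eC[d dD di]; rewrite ltNge; apply/negP => gi; apply: nz.
  have [Vr rP] := repP i; exists (rep i); split=> // k kn.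
  have ci : cell (rep i) = cell (pt d) by rewrite di; apply: rP; exists (pt d).
  have -> : f k (pt d0) - f k (rep i) =
      - (f k (pt d) - f k (pt d0)) - (f k (rep i) - f k (pt d)) by ring.
  apply: le_trans (ler_normB _ _) _; rewrite normrN [leRHS]splitr; apply: lerD.
    exact: pt_close.
  exact: cellP.
set a := g (pt d0) in gy.
have aM : `|a| <= M by exact: blinV.
(* [pt d0] is the average of the [y i] with weights [occ i d0]. By [gy] the part [e i] of the
   weights contributes more than [eps] each, and the rest has total weight at most [N], too little
   to compensate. *)
have ea : \sum_i (occ i d0)%:R * (g (y i) - a) = 0.
  under eq_bigr do rewrite mulrBr.
  rewrite sumrB -mulr_suml -natr_sum sum_occ.
  rewrite {1}/a /pt (blin_average _ _ bg) mulrA mulfV ?mul1r ?subrr //.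
  by rewrite gt_eqF.
have : \sum_i ((e i)%:R * eps - rest d0 i * (M + M)) <= 0.
  rewrite -[leRHS]ea; apply: ler_sum => i _.
  have -> : (occ i d0)%:R = (e i)%:R + rest d0 i :> R by rewrite /rest; ring.
  rewrite [leRHS]mulrDl; apply: lerD.
    have [->|ei] := posnP (e i); first by rewrite !mul0r.
    by apply: ler_wpM2l; rewrite ?ler0n //; have := gy i ei; lra.
  rewrite -mulrN; apply: ler_wpM2l; first exact: rest0.
  have := blinV g (y i) bg (Vy i).
  by move: aM; rewrite !ler_norml => /andP[h1 h2] /andP[h3 h4]; lra.
rewrite sumrB -!mulr_suml.
have r1 : \sum_i rest d0 i * (M + M) <= N * (M + M).
  by rewrite -mulr_suml; apply: ler_wpM2r => //; rewrite addr_ge0.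
have e1 : (m%:R - N) * eps <= (\sum_i (e i)%:R) * eps.
  by apply: ler_wpM2r; [exact: ltW|lra].
have : 4 * N * M < (m%:R - N) * eps.
  by rewrite -ltr_pdivrMr //; lra.
rewrite -mulr_suml in r1.
have NM : 0 <= N * M by rewrite mulr_ge0.
lra.
Qed.

End ApproximateFixedPoint.

(** * The De Blasi measure of a sequence *)

Section Means.
Context {R : realType}.
Implicit Types (g : nat -> R).

Lemma eval_mean n : is_mean (fun g => g n).
Proof. by split. Qed.

Lemma average_mean m (lam : 'I_m -> (nat -> R) -> R) : (0 < m)%N ->
  (forall i, is_mean (lam i)) -> is_mean (fun g => m%:R^-1 * \sum_i lam i g).
Proof.
move=> m0 lamP; split=> [g h bg bh|a g bg|g bg g0|].
- by rewrite -mulrDr -big_split; congr (_ * _); apply: eq_bigr => i _; rewrite (meanD (lamP i)).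
- rewrite mulrCA; congr (_ * _); rewrite mulr_sumr; apply: eq_bigr => i _.
  by rewrite (meanZ (lamP i)).
- by rewrite mulr_ge0 ?invr_ge0 // sumr_ge0 // => i _; exact: (mean_ge0 (lamP i)).
rewrite (eq_bigr (fun=> 1)) => [|i _]; last exact: (mean1 (lamP i)).
by rewrite sumr_const card_ord mulVf // pnatr_eq0 -lt0n.
Qed.

Lemma ultra_mean (U : set_system nat) (lam : nat -> (nat -> R) -> R) :
  UltraFilter U -> (forall n, is_mean (lam n)) ->
  exists mu, is_mean mu /\
    forall g, bounded_seq g -> lam n g @[n --> U] --> mu g.
Proof.
move=> UU lamP.
have /choice[mu muP] : forall g, exists l : R, bounded_seq g -> lam n g @[n --> U] --> l.
  move=> g; have [[c gc]|nb] := pselect (bounded_seq g); last by exists 0.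
  have [|l lU] := @ultra_bounded_cvg R nat U (fun n => lam n g) c UU.
    by apply: filterE => n /=; exact: mean_norm_le.
  by exists l.
exists mu; split=> //.
have uniq g l : bounded_seq g -> lam n g @[n --> U] --> l -> mu g = l.
  by move=> /muP H1 H2; apply: (cvg_unique (@norm_hausdorff _ R^o) H1 H2).
split=> [g h bg bh|a g bg|g bg g0|].
- apply: uniq; first exact: bounded_seqD.
  under eq_fun do rewrite (meanD (lamP _) bg bh).
  by apply: cvgD; exact: muP.
- apply: uniq; first exact: bounded_seqZ.
  under eq_fun do rewrite (meanZ (lamP _) _ bg).
  by apply: cvgM; [exact: cvg_cst|exact: muP].
- by apply: (cvg_ge_bound (muP _ bg)); apply: filterE => n; exact: (mean_ge0 (lamP n)).
apply: uniq; first exact: bounded_seq_cst.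
under eq_fun do rewrite (mean1 (lamP _)).
exact: cvg_cst.
Qed.

End Means.

Section DeBlasi.
Context {R : realType} {E : banachAlgType R}.
Implicit Types (u v k : nat -> E) (e : R).

(** For a bounded sequence, [de_blasi (range u)] is the infimum of the positive [e] with this
    property. *)
Definition near_relwcs u e : Prop :=
  exists2 k, relwcs k & forall n, `|u n - k n| <= e.

Lemma de_blasi_cover (W : set E) (M e : R) : (forall x, W x -> `|x| <= M) ->
  de_blasi W < e -> exists2 K : set E, weakly_compact K & W `<=` sum_set K (cball e).
Proof.
move=> WM; rewrite /de_blasi; set A := [set d | _] => We'.
have [d [d0 [K [Kc WK]]] de] : exists2 d, A d & d < e.
  apply: contrapT => nA.
  (* Boundedness makes the set of radii nonempty; the infimum of an empty set would be 0 and say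
     nothing. *)
  have M1 : A (`|M| + 1).
    split; first by rewrite ltr_wpDl.
    exists [set 0]; split.
      by apply: compact_set1.
    move=> x Wx; exists 0 => //; exists x; rewrite ?add0r // /cball /=.
    by apply: le_trans (WM _ Wx) _; have := ler_norm M; lra.
  have : e <= inf A.
    apply: le_inf_of => [|d Ad]; first by exists (`|M| + 1).
    by rewrite leNgt; apply/negP => de; apply: nA; exists d.
  by rewrite leNgt We'.
exists K => // x /WK[y Ky [z zd <-]]; exists y => //; exists z => //.
by rewrite /cball /=; apply: le_trans zd _; exact: ltW.
Qed.

Lemma de_blasi_near u (M e : R) : (forall n, `|u n| <= M) ->
  de_blasi (range u) < e -> near_relwcs u e.
Proof.
move=> uM ue; have [|K Kc uK] := @de_blasi_cover (range u) M e _ ue.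
  by move=> _ [n _ <-].
have /choice[k kP] : forall n, exists y, K y /\ `|u n - y| <= e.
  move=> n; have [y Ky [z ze <-]] : sum_set K (cball e) (u n) by apply: uK; exists n.
  by exists y; rewrite addrAC subrr add0r.
exists k => [|n]; last exact: (kP n).2.
by apply: (weakly_compact_relwcs Kc) => n; exact: (kP n).1.
Qed.

Lemma near_de_blasi u e : 0 < e -> near_relwcs u e -> de_blasi (range u) <= e.
Proof.
move=> e0 [k kc uk]; have [K Kc kK] := relwcs_weakly_compact kc.
apply: (@inf_lower R _ 0); first by move=> d [/ltW].
split=> //; exists K; split=> // _ [n _ <-].
by exists (k n) => //; exists (u n - k n); rewrite ?subrKC // /cball /=.
Qed.

Lemma de_blasi_ge0 (W : set E) : 0 <= de_blasi W.
Proof.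
rewrite /de_blasi; set A := [set d | _].
have [[d Ad]|A0] := pselect (A !=set0).
  by apply: le_inf_of => [|b [/ltW]]; first by exists d.
have -> : A = set0 by apply/seteqP; split=> // x Ax; apply: A0; exists x.
by rewrite inf0.
Qed.

Lemma de_blasi0_relwcs u (M : R) : (forall n, `|u n| <= M) ->
  de_blasi (range u) <= 0 -> relwcs u.
Proof.
move=> uM u0; apply: relwcs_approx => e e0.
by apply: de_blasi_near uM _; exact: le_lt_trans u0 e0.
Qed.

Lemma relwcs_de_blasi0 u : relwcs u -> de_blasi (range u) = 0.
Proof.
move=> uc; apply/eqP; rewrite eq_le de_blasi_ge0 andbT; apply/ler_addgt0Pr => e e0.
rewrite add0r; apply: near_de_blasi => //; exists u => // n.
by rewrite subrr normr0 ltW.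
Qed.

End DeBlasi.

(** * Condensing maps *)

Section CountableHull.
Context {R : realType} {E : completeNormedModType R}.
Variables (h : E -> E) (x0 : E).

Definition seq_average (v : nat -> E) (s : seq nat) : E :=
  if s is [::] then x0 else average (fun i => v (tnth (in_tuple s) i)).

Definition hull_step (v : nat -> E) (c : nat) : E :=
  match (unpickle c : option (nat + seq nat)) with
  | Some (inl i) => h (v i)
  | Some (inr s) => seq_average v s
  | None => x0
  end.

Definition hull_stage j : nat -> E := iter j hull_step (fun=> x0).

(* An enumeration of the closure of x0 under h and finite averages. *)
Definition hull_enum (c : nat) : E :=
  let p := odflt (0, 0)%N (unpickle c) in hull_stage p.1 p.2.

Lemma hull_enum_stage j i : hull_enum (pickle (j, i)) = hull_stage j i.
Proof. by rewrite /hull_enum pickleK. Qed.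

Lemma hull_ind (P : E -> Prop) : P x0 -> (forall x, range hull_enum x -> P x -> P (h x)) ->
  (forall m (y : 'I_m -> E), (0 < m)%N -> (forall i, range hull_enum (y i) /\ P (y i)) ->
    P (average y)) -> forall n, P (hull_enum n).
Proof.
move=> P0 Ph Pa n; rewrite /hull_enum; case: (odflt _ _) => j i /=.
elim: j i => [//|j IH] i /=; rewrite /hull_step.
have rj m : range hull_enum (hull_stage j m).
  by exists (pickle (j, m)) => //; rewrite hull_enum_stage.
case: unpickle => [[k|[|k s]]|] //; first by apply: Ph.
by apply: Pa => // t; split.
Qed.

Lemma hull_x0 : range hull_enum x0.
Proof. by exists (pickle (0, 0)%N) => //; rewrite hull_enum_stage. Qed.

(** The average of a one-element list is that element, so the stages increase. Finitely many terms
    of the hull therefore lie in a common stage, where their average can be formed. *)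
Lemma hull_stageS j i : exists i', hull_stage j.+1 i' = hull_stage j i.
Proof.
exists (pickle (inr [:: i] : nat + seq nat)) => /=.
rewrite /hull_step pickleK /= /average /= big_ord1 invr1 scale1r.
by rewrite (tnth_nth 0%N).
Qed.

Lemma hull_stage_le j j' i : (j <= j')%N -> exists i', hull_stage j' i' = hull_stage j i.
Proof.
elim: j' => [|j' IH]; first by rewrite leqn0 => /eqP ->; exists i.
rewrite leq_eqVlt => /predU1P[->|]; first by exists i.
by rewrite ltnS => /IH[k <-]; exact: hull_stageS.
Qed.

Lemma hull_h x : range hull_enum x -> range hull_enum (h x).
Proof.
move=> [n _ <-]; have [j [i ->]] : exists j i, hull_enum n = hull_stage j i.
  by rewrite /hull_enum; case: (odflt _ _) => j i; exists j, i.
exists (pickle (j.+1, pickle (inl i : nat + seq nat))) => //.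
by rewrite hull_enum_stage /= /hull_step pickleK.
Qed.

Lemma hull_average : average_closed (range hull_enum).
Proof.
move=> m y m0 Vy.
have /choice[c cP] : forall i, exists p : nat * nat, hull_stage p.1 p.2 = y i.
  by move=> i; have [n _ <-] := Vy i; exists (odflt (0, 0)%N (unpickle n)).
pose J := (\max_i (c i).1)%N.
have /choice[d dP] : forall i, exists k, hull_stage J k = y i.
  move=> i; rewrite -(cP i); apply: hull_stage_le.
  by rewrite /J (leq_bigmax_cond (F := fun i => (c i).1)).
pose s := codom d.
have ss : size s = m by rewrite size_codom card_ord.
exists (pickle (J.+1, pickle (inr s : nat + seq nat))) => //.
rewrite hull_enum_stage /= /hull_step pickleK.
have : (0 < size s)%N by rewrite ss.
have yd i : y i = hull_stage J (nth 0%N s i).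
  rewrite -dP; congr hull_stage; rewrite /s codomE.
  by rewrite (nth_map i) ?size_enum_ord // nth_ord_enum.
have -> : average y = average (fun i => hull_stage J (tnth (in_tuple s) i)).
  rewrite /average; congr (_%:R^-1 *: _) => //.
  transitivity (\sum_(i < m) hull_stage J (nth 0%N s i)).
    by apply: eq_bigr => i _; exact: yd.
  rewrite -(big_mkord xpredT (fun i => hull_stage J (nth 0%N s i))) -ss big_mkord.
  by apply: eq_bigr => i _; rewrite (tnth_nth 0%N).
by case: s {ss yd}.
Qed.

End CountableHull.

Lemma convex_average (R : realType) (E : completeNormedModType R) (W : set E) :
  convex W -> average_closed W.
Proof.
move=> cW m y; case: m y => // m y _ Wy; rewrite /average.
elim: m y Wy => [|m IH] y Wy; first by rewrite big_ord1 invr1 scale1r.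
rewrite big_ord_recr /=.
pose t : R := m.+1%:R / m.+2%:R.
have m1 : (0 : R) < m.+1%:R by rewrite ltr0n.
have m2 : (0 : R) < m.+2%:R by rewrite ltr0n.
have t01 : 0 <= t <= 1.
  by rewrite /t divr_ge0 //= ler_pdivrMr // mul1r ler_nat.
have t1 : 1 - t = m.+2%:R^-1.
  have e : m.+2%:R = m.+1%:R + 1 :> R by rewrite -natr1.
  rewrite /t e; move: (m.+1%:R) m1 => a a0; field.
  by rewrite gt_eqF //; lra.
have := cW _ _ t t01 (IH (fun i => y (widen_ord (leqnSn _) i)) (fun i => Wy _))
  (Wy ord_max).
by rewrite t1 scalerA /t mulrAC mulfV ?gt_eqF // mul1r -scalerDr.
Qed.

Section CondensingFixedPoint.
Context {R : realType} {E : banachAlgType R}.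

(** Along an ultrafilter the means themselves converge to a mean, whose barycenter is the weak limit
    of the [y n]; hence [y] is relatively weakly compact. *)
Lemma near_barycenters (u k : nat -> E) (M e : R) (y : nat -> E) :
  relwcs k -> (forall n, `|k n| <= M) ->
  (forall n, exists lam, is_mean lam /\ forall B f, blin B f -> lam (f \o k) = f (y n)) ->
  (forall n, `|u n - y n| <= e) -> near_relwcs u e.
Proof.
move=> kc kM /choice[lam lamP] uy; exists y => // U UU.
have [mu [mumean mulim]] := ultra_mean UU (fun n => (lamP n).1).
have [x xP] := mean_barycenter kc kM mumean.
exists x => B f bf; rewrite -(xP _ _ bf).
have -> : (fun n => f (y n)) = fun n => lam n (f \o k).
  by apply/funext => n; rewrite ((lamP n).2 _ _ bf).
apply: mulim; exists (`|B| * M) => n; apply: le_trans (bf.2 _) _.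
apply: le_trans (_ : `|B| * `|k n| <= _); first by rewrite ler_wpM2r // ler_norm.
by rewrite ler_wpM2l.
Qed.

(** Let [k] be relatively weakly compact and within [b + e] of [h \o v]. By induction on the hull,
    every [v n] is within [b + e] of the barycenter of a mean on [k] with [x0] put in front. *)
Lemma de_blasi_hull (h : E -> E) x0 (M : R) :
  (forall n, `|hull_enum h x0 n| <= M) ->
  de_blasi (range (hull_enum h x0)) <= de_blasi (range (h \o hull_enum h x0)).
Proof.
move=> vM; set v := hull_enum h x0 in vM *.
have hM n : `|h (v n)| <= M.
  by have [m _ <-] := hull_h (ex_intro2 _ _ n I erefl : range (hull_enum h x0) (v n)).
apply/ler_addgt0Pr => e e0.
set b := de_blasi (range (h \o v)).
have be : b < b + e by rewrite ltrDl.
have [k kc hk] := de_blasi_near hM be.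
have b0 : 0 <= b := de_blasi_ge0 _.
apply: near_de_blasi; first by rewrite ltr_wpDl.
pose k' n := if n is n'.+1 then k n' else x0.
have M0 : 0 <= M by apply: le_trans (vM 0).
have k'c : relwcs k'.
  move=> U UU; have [] := in_ultra_setVsetC [set 0%N] UU => U0.
    exists x0 => B f bf; apply: cvg_near_cst.
    by apply: filterS U0 => n /= ->.
  have [x kx] := relwcs_comp predn kc UU.
  exists x => B f bf; apply: cvg_trans (kx B f bf); apply: near_eq_cvg.
  by apply: filterS U0 => -[|n] //= /(_ erefl).
have k'M n : `|k' n| <= M + (b + e).
  case: n => [|n] /=.
    have [m _ <-] := hull_x0 h x0; apply: le_trans (vM m) _.
    by rewrite lerDl addr_ge0 // ltW.
  have := ler_normB (h (v n)) (h (v n) - k n).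
  rewrite opprB addrC subrK => /le_trans; apply.
  by apply: lerD; [exact: hM|exact: hk].
pose P x := exists y, (exists lam, is_mean lam /\
    forall B f, blin B f -> lam (f \o k') = f y) /\ `|x - y| <= b + e.
have approx : forall n, P (v n).
  apply: (@hull_ind R E h x0 P) => [|_ [n _ <-] _|m y m0 yP].
  - exists x0; rewrite subrr normr0; split; last by rewrite addr_ge0 // ltW.
    by exists (fun g => g 0%N); split; first exact: eval_mean.
  - exists (k n); split; last exact: hk.
    by exists (fun g => g n.+1); split; first exact: eval_mean.
  have /choice[z zP] : forall i, exists z, (exists lam, is_mean lam /\
      forall B f, blin B f -> lam (f \o k') = f z) /\ `|y i - z| <= b + e.
    by move=> i; have [_ [z zP]] := yP i; exists z.
  have /choice[lam lamP] : forall i, exists lam, is_mean lam /\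
      forall B f, blin B f -> lam (f \o k') = f (z i).
    by move=> i; have [? _] := zP i.
  exists (average z); split.
    exists (fun g => m%:R^-1 * \sum_i lam i g); split.
      by apply: average_mean => // i; exact: (lamP i).1.
    move=> B f bf; rewrite bf.1.2 (linear_form_sum _ _ _ bf.1); congr (_ * _).
    by apply: eq_bigr => i _; exact: (lamP i).2 _ _ bf.
  rewrite /average -scalerBr -sumrB normrZ gtr0_norm ?invr_gt0 ?ltr0n //.
  rewrite mulrC ler_pdivrMr ?ltr0n //; apply: le_trans (ler_norm_sum _ _ _) _.
  apply: le_trans (_ : \sum_(i < m) (b + e) <= _).
    by apply: ler_sum => i _; exact: (zP i).2.
  by rewrite sumr_const card_ord mulr_natr.
have /choice[y yP] := approx.
exact: (near_barycenters k'c k'M (fun n => (yP n).1) (fun n => (yP n).2)).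
Qed.

Theorem condensing_fixed_point (S : set E) (H : E -> set E) (M : R) :
  S !=set0 -> closed S -> convex S ->
  (forall x, S x -> [/\ H x !=set0, H x `<=` S & convex (H x)]) ->
  (forall x y, S x -> H x y -> `|y| <= M) ->
  (forall (u v : nat -> E) x y, (forall n, S (u n)) -> (forall n, `|u n| <= M) ->
    (forall n, H (u n) (v n)) -> S x -> wlim \oo u x -> wlim \oo v y -> H x y) ->
  (forall u v : nat -> E, (forall n, S (u n)) -> (forall n, `|u n| <= M) ->
    (forall n, H (u n) (v n)) -> 0 < de_blasi (range u) ->
    de_blasi (range v) < de_blasi (range u)) ->
  exists2 x, S x & H x x.
Proof.
move=> [s0 Ss0] clS cvS HS HM Hgraph Hcond.
have [x0 Hx0] : H s0 !=set0 by have [] := HS _ Ss0.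
have Sx0 : S x0 by have [_ + _] := HS _ Ss0; apply.
have x0M : `|x0| <= M := HM _ _ Ss0 Hx0.
have /choice[h hP] : forall x, exists y, S x -> H x y.
  move=> x; have [Sx|nSx] := pselect (S x); last by exists 0.
  by have [[y Hy] _ _] := HS _ Sx; exists y.
pose v := hull_enum h x0; pose V := range v.
have vS n : S (v n) /\ `|v n| <= M.
  apply: (@hull_ind R E h x0 (fun x => S x /\ `|x| <= M)) => [|x Vx [Sx xM]|m y m0 yP] //.
    split; last exact: HM Sx (hP _ Sx).
    by have [_ + _] := HS _ Sx; apply; exact: hP.
  split; first by apply: (convex_average cvS) => // i; have [_ []] := yP i.
  rewrite /average normrZ gtr0_norm ?invr_gt0 ?ltr0n //.
  rewrite mulrC ler_pdivrMr ?ltr0n //; apply: le_trans (ler_norm_sum _ _ _) _.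
  apply: le_trans (_ : \sum_(i < m) M <= _).
    by apply: ler_sum => i _; have [_ []] := yP i.
  by rewrite sumr_const card_ord mulr_natr.
have vM n : `|v n| <= M := (vS n).2.
have vc : relwcs v.
  apply: (de_blasi0_relwcs vM); rewrite leNgt; apply/negP => v0.
  have := Hcond v (h \o v) (fun n => (vS n).1) vM (fun n => hP _ (vS n).1) v0.
  by rewrite ltNge (de_blasi_hull vM).
have [f [bf fsep]] := separating_family v.
have VM x : V x -> `|x| <= M by move=> [n _ <-].
have hV x : V x -> V (h x) by exact: hull_h.
have V0 : V !=set0 by exists (v 0%N), 0%N.
(* The indices [s n] work for all functionals of norm at most 1: the limit [x] must be fixed before
   the functional separating it from [H x] is known. *)
have /choice[s sP] : forall n, exists i, forall g, blin 1 g -> exists z,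
    [/\ V z, forall k, (k < n)%N -> `|f k (v i) - f k z| <= n.+1%:R^-1 &
        g (h z) <= g (v i) + n.+1%:R^-1].
  move=> n; have e0 : (0 : R) < n.+1%:R^-1 by rewrite invr_gt0 ltr0n.
  have [x [[i _ <-] xP]] := approximate_fixed_point n V0 VM hV
    (@hull_average _ _ h x0) bf e0.
  by exists i.
have [U [UU oU]] := free_ultrafilter.
have [x sx] := relwcs_comp s vc UU.
have Sx : S x.
  by apply: (mazur clS cvS _ sx); apply: filterE => n; exact: (vS _).1.
have xM : `|x| <= M.
  by apply: (wlim_norm_le sx); apply: filterE => n; exact: vM.
exists x => //; apply: contrapT => nHx.
have [Hx0' HxS cvHx] := HS _ Sx.
(* Closedness of the values comes from the graph along a constant sequence of arguments. *)
have clHx : closed (H x).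
  move=> y /closure_normP yH.
  have /choice[w wP] : forall n, exists w, H x w /\ `|y - w| < n.+1%:R^-1.
    move=> n; have e0 : (0 : R) < n.+1%:R^-1 by rewrite invr_gt0 ltr0n.
    by have [w Hw yw] := yH _ e0; exists w.
  apply: (Hgraph (fun=> x) w x y) => //.
  - by move=> n; exact: (wP n).1.
  - exact: wlim_cst.
  move=> B g bg; apply/cvgrPdistC_le => e e0.
  pose c := `|B| + 1; have c0 : 0 < c by rewrite ltr_wpDl.
  have ec : 0 < e / c by rewrite divr_gt0.
  near=> n; apply: le_trans (blin_dist _ _ bg) _.
  have yn : `|w n - y| <= e / c.
    rewrite distrC; apply: le_trans (ltW (wP n).2) _; apply: ltW.
    by near: n; exact: near_harmonic.
  apply: le_trans (_ : c * `|w n - y| <= _).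
    by apply: ler_wpM2r => //; rewrite /c; have := ler_norm B; lra.
  by rewrite mulrC -ler_pdivlMr.
have [g [d [bg d0 gH]]] := closed_convex_separation clHx cvHx Hx0' nHx.
have /choice[s' s'P] : forall n, exists j,
    (forall k, (k < n)%N -> `|f k (v (s n)) - f k (v j)| <= n.+1%:R^-1) /\
    g (h (v j)) <= g (v (s n)) + n.+1%:R^-1.
  by move=> n; have [_ [[j _ <-] h1 h2]] := sP n g bg; exists j.
have /choice[s'' s''P] : forall n, exists j, v j = h (v (s' n)).
  move=> n; have [|j _ jP] := hV (v (s' n)); first by exists (s' n).
  by exists j.
have [z zP] := relwcs_comp s' vc UU.
have [w wP] := relwcs_comp s'' vc UU.
have vspan n : rspan v (v n) by exact: rspan_gen.
have zx : z = x.
  apply: fsep; [exact: wlim_rspan zP (fun n => vspan (s' n))|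
    exact: wlim_rspan sx (fun n => vspan (s n))|move=> k].
  apply/eqP; rewrite eq_sym -subr_eq0 -normr_le0; apply/ler_addgt0Pl => e e0.
  rewrite addr0.
  have fc : f k (v (s n)) - f k (v (s' n)) @[n --> U] --> f k x - f k z.
    by apply: cvgB; [exact: sx _ _ (bf k)|exact: zP _ _ (bf k)].
  apply: (cvg_norm_bound fc); apply: oU; near=> n => /=.
  have kn : (k < n)%N by near: n; exists k.+1.
  apply: le_trans ((s'P n).1 k kn) _; apply: ltW.
  by near: n; exact: near_harmonic.
have Hxw : H x w.
  (* The arguments and their images under [h] must converge along the same indices; the zeroth
     sequence holds the arguments, all others the images. *)
  pose u2 i := if i is 0%N then v \o s' else v \o s''.
  pose y2 i := if i is 0%N then x else w.
  have [||t [_ tP]] := @relwcs_subsequence R E u2 y2 U setT UU _ _ filterT.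
  - by case=> [|i]; exact: relwcs_comp.
  - by case=> [|i] //=; rewrite -zx.
  apply: (Hgraph (u2 0%N \o t) (u2 1%N \o t) x w) => //.
  - by move=> n; exact: (vS _).1.
  - by move=> n; exact: vM.
  - by move=> n /=; rewrite s''P; apply: hP; exact: (vS _).1.
have := gH _ Hxw; have : g w <= g x.
  apply/ler_addgt0Pr => e e0; rewrite addrC -lerBlDr.
  have gc : g (v (s'' n)) - g (v (s n)) @[n --> U] --> g w - g x.
    by apply: cvgB; [exact: wP _ _ bg|exact: sx _ _ bg].
  apply: (cvg_le_bound gc); apply: oU; near=> n => /=.
  rewrite s''P lerBlDl; apply: le_trans (s'P n).2 _; rewrite lerD2l; apply: ltW.
  by near: n; exact: near_harmonic.
lra.
Unshelve. all: by end_near. Qed.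

End CondensingFixedPoint.

(** * Products in Banach algebras *)

(** The restriction [e <= 1] allows terms quadratic in [e] to be absorbed into the linear error. *)
Lemma ler_eps_linear (R : realType) (X Y K : R) : 0 <= K ->
  (forall e, 0 < e -> e <= 1 -> X <= Y + e * K) -> X <= Y.
Proof.
move=> K0 H; apply/ler_addgt0Pr => d d0.
have K1 : 0 < K + 1 by rewrite ltr_wpDl.
pose e := Num.min 1 (d / (K + 1)).
have e0 : 0 < e by rewrite /e lt_min ltr01 divr_gt0.
have e1 : e <= 1 by rewrite /e ge_min lexx.
have ed : e <= d / (K + 1) by rewrite /e ge_min lexx orbT.
apply: le_trans (H e e0 e1) _; rewrite lerD2l.
have : e * (K + 1) <= d by rewrite -ler_pdivlMr.
by rewrite mulrDr mulr1; lra.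
Qed.

Section SetFacts.
Context {R : realType} {E : completeNormedModType R}.
Implicit Types (W : set E) (x y : E).

Lemma convex_set_convex W : convex_set W -> convex W.
Proof.
move=> cW x y t /andP[t0 t1] Wx Wy.
by have := cW x y (Itv01 t0 t1) (mem_set Wx) (mem_set Wy); rewrite inE.
Qed.

Lemma bounded_setP W : bounded_set W <-> exists M, forall x, W x -> `|x| <= M.
Proof.
split=> [/pinfty_ex_gt0[M _ WM]|[M WM]]; first by exists M.
by exists M; split; [exact: num_real|move=> N MN x /WM /le_trans; apply; exact: ltW].
Qed.

(** An ultrafilter on [nat] is either principal or finer than [\oo]. *)
Lemma wlim_relwcs (u : nat -> E) x : wlim \oo u x -> relwcs u.
Proof.
move=> ux U UU; have [[n Un]|nU] := pselect (exists n, U [set n]).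
  exists (u n) => B f bf; apply: cvg_near_cst.
  by apply: filterS Un => m /= ->.
exists x; apply: wlim_sub ux => A [N _ NA].
suff : U [set n | (N <= n)%N] by apply: filterS.
elim: (N) => [|m IH]; first exact: filterE.
have Um : U (~` [set m]) by apply: ultra_not => Um; apply: nU; exists m.
by apply: filterS (filterI IH Um) => n [/= mn nm]; rewrite ltn_neqAle mn andbT; apply/eqP => mn'; apply: nm.
Qed.

End SetFacts.

Section BanachAlgebra.
Context {R : realType} {E : banachAlgType R}.
Implicit Types (W : set E) (x y : E) (u a b c : nat -> E).

Lemma norm_set_ge W x : bounded_set W -> W x -> `|x| <= norm_set W.
Proof.
move=> /bounded_setP[M WM] Wx; apply: ub_le_sup; last by exists x.
by exists M => _ [y Wy <-]; exact: WM.
Qed.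

Lemma de_blasi_sub W W' : W `<=` W' -> bounded_set W' -> de_blasi W <= de_blasi W'.
Proof.
move=> WW' /bounded_setP[M WM]; apply/ler_addgt0Pr => e e0.
have be : de_blasi W' < de_blasi W' + e by rewrite ltrDl.
have [K Kc WK] := de_blasi_cover WM be.
apply: (@inf_lower R _ 0); first by move=> d [/ltW].
split; first by rewrite ltr_wpDl ?de_blasi_ge0.
by exists K; split=> //; exact: subset_trans WK.
Qed.

Lemma relwcs_cst x : relwcs (fun=> x : E).
Proof. by move=> U UU; exists x; exact: wlim_cst. Qed.

Lemma de_blasi_le_norm u (M : R) : 0 <= M -> (forall n, `|u n| <= M) ->
  de_blasi (range u) <= M.
Proof.
move=> M0 uM; apply/ler_addgt0Pr => e e0.
apply: near_de_blasi; first by rewrite ltr_wpDl.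
exists (fun=> 0); first exact: relwcs_cst.
by move=> n; rewrite subr0; apply: le_trans (uM n) _; rewrite lerDl ltW.
Qed.

(** Condition (P) extends from sequences to ultrafilters: if the products stayed away from the limit
    on a set of [U], indices taken inside that set would give weakly convergent sequences violating
    (P). *)
Lemma wlim_bmul (U : set_system nat) a b x y : condition_P E -> UltraFilter U ->
  relwcs a -> relwcs b -> wlim U a x -> wlim U b y ->
  wlim U (fun n => bmul (a n) (b n)) (bmul x y).
Proof.
move=> hP UU ac bc ax b_y B f bf; apply/cvgrPdistC_le => e e0.
apply: contrapT => nU; have {}nU := ultra_not UU nU.
pose u i := if i is 0%N then a else b.
pose z i := if i is 0%N then x else y.
have [||t [nt tP]] := @relwcs_subsequence R E u z U _ UU _ _ nU.
- by case.
- by case.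
have ab : weak_cvg (fun n => bmul (a (t n)) (b (t n))) (bmul x y).
  by apply: hP; apply/weak_cvg_wlim; [exact: (tP 0%N)|exact: (tP 1%N)].
move/weak_cvg_wlim: ab => /(_ B f bf) /cvgrPdistC_le /(_ _ e0) /filter_ex[n ne].
exact: (nt n).
Qed.

Lemma relwcs_bmul a b : condition_P E -> relwcs a -> relwcs b ->
  relwcs (fun n => bmul (a n) (b n)).
Proof.
move=> hP ac bc U UU; have [x ax] := ac U UU; have [y b_y] := bc U UU.
by exists (bmul x y); exact: wlim_bmul.
Qed.

Lemma bmulBl x y z : bmul (x - y) z = bmul x z - bmul y z :> E.
Proof. by rewrite -scaleN1r bmulDl bmulZl scaleN1r. Qed.

Lemma bmulBr x y z : bmul z (x - y) = bmul z x - bmul z y :> E.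
Proof. by rewrite -scaleN1r bmulDr bmulZr scaleN1r. Qed.

(* The factor 2 comes from bounding the measure of a by Ma in the cross term. *)
Lemma de_blasi_bmulD a b c (Ma Mb Mc : R) : condition_P E ->
  (forall n, `|a n| <= Ma) -> (forall n, `|b n| <= Mb) -> (forall n, `|c n| <= Mc) ->
  de_blasi (range (fun n => bmul (a n) (b n) + c n)) <=
  de_blasi (range a) * Mb + 2 * Ma * de_blasi (range b) + de_blasi (range c).
Proof.
move=> hP aM bM cM.
set ba := de_blasi (range a); set bb := de_blasi (range b); set bc := de_blasi (range c).
have Ma0 : 0 <= Ma by apply: le_trans (aM 0%N).
have Mb0 : 0 <= Mb by apply: le_trans (bM 0%N).
have ba0 : 0 <= ba := de_blasi_ge0 _.
have bb0 : 0 <= bb := de_blasi_ge0 _.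
have bc0 : 0 <= bc := de_blasi_ge0 _.
have baM : ba <= Ma by exact: de_blasi_le_norm.
have K0 : 0 <= Mb + 2 * Ma + bb + 2 by lra.
apply: (ler_eps_linear K0) => e e0 e1.
have lt (r : R) : r < r + e by rewrite ltrDl.
have [a' a'c aa'] := de_blasi_near aM (lt ba).
have [b' b'c bb'] := de_blasi_near bM (lt bb).
have [c' c'c cc'] := de_blasi_near cM (lt bc).
(* From [a b - a' b' = (a - a') b + a' (b - b')], with [|a'| <= Ma + ba + e]. *)
pose r := (ba + e) * Mb + (Ma + (ba + e)) * (bb + e) + (bc + e).
apply: le_trans (_ : r <= _).
  apply: near_de_blasi.
    have h1 : 0 <= (ba + e) * Mb by rewrite mulr_ge0 //; lra.
    have h2 : 0 <= (Ma + (ba + e)) * (bb + e) by rewrite mulr_ge0 //; lra.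
    by rewrite /r; lra.
  exists (fun n => bmul (a' n) (b' n) + c' n).
    by apply: relwcsD => //; exact: relwcs_bmul.
  move=> n; have -> : bmul (a n) (b n) + c n - (bmul (a' n) (b' n) + c' n) =
      bmul (a n - a' n) (b n) + bmul (a' n) (b n - b' n) + (c n - c' n).
    by rewrite bmulBl bmulBr subrKA opprD addrACA.
  apply: le_trans (ler_normD _ _) _; apply: lerD => //.
  apply: le_trans (ler_normD _ _) _; apply: lerD.
    by apply: le_trans (ler_norm_bmul _ _) _; exact: ler_pM.
  apply: le_trans (ler_norm_bmul _ _) _; apply: ler_pM => //.
  have -> : a' n = a n - (a n - a' n) by rewrite opprB addrC subrK.
  by apply: le_trans (ler_normB _ _) _; apply: lerD.
have ee : e * e <= e by rewrite ler_piMl // ltW.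
have bab : ba * bb <= Ma * bb by exact: ler_wpM2r.
have eba : e * ba <= e * Ma by apply: ler_wpM2l => //; exact: ltW.
by rewrite /r; nra.
Qed.

(** All sequences are extracted along one [t]. Since [t] need not tend to infinity, convergence of
    [u] is not inherited by [u \o t]; so [u], which will be the argument of [B], takes part in the
    extraction. *)
Lemma solution_graph (A C : E -> set E) (x_ a y_ c z_ u : nat -> E) x z w :
  condition_P E ->
  weakly_seq_closed_graph setT A -> weakly_seq_closed_graph setT C ->
  relwcs a -> relwcs c -> relwcs y_ ->
  (forall n, A (x_ n) (a n)) -> (forall n, C (x_ n) (c n)) ->
  (forall n, z_ n = bmul (a n) (y_ n) + c n) ->
  wlim \oo x_ x -> wlim \oo z_ z -> wlim \oo u w ->
  exists (t : nat -> nat) (a' y c' : E), [/\ A x a', C x c', wlim \oo (u \o t) w,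
    wlim \oo (y_ \o t) y & z = bmul a' y + c'].
Proof.
move=> hP Ag Cg ac cc yc Aa Cc zE xx zz uw.
have [U [UU oU]] := free_ultrafilter.
have [a' aa'] := ac U UU; have [c' cc'] := cc U UU; have [y yy] := yc U UU.
pose f i := match i with 0 => a | 1 => c | 2 => y_ | 3 => x_ | _ => u end%N.
pose l i := match i with 0 => a' | 1 => c' | 2 => y | 3 => x | _ => w end%N.
have [||t [_ tP]] := @relwcs_subsequence R E f l U setT UU _ _ filterT.
- by case=> [|[|[|[|n]]]] //=; [exact: wlim_relwcs xx|exact: wlim_relwcs uw].
- by case=> [|[|[|[|n]]]] //=; [exact: wlim_sub oU xx|exact: wlim_sub oU uw].
exists t, a', y, c'; split.
- apply: (Ag (x_ \o t) (a \o t)) => // [|n|]; last 1 first.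
  + by apply/weak_cvg_wlim; exact: (tP 0%N).
  + by apply/weak_cvg_wlim; exact: (tP 3%N).
  exact: Aa.
- apply: (Cg (x_ \o t) (c \o t)) => // [|n|]; last 1 first.
  + by apply/weak_cvg_wlim; exact: (tP 1%N).
  + by apply/weak_cvg_wlim; exact: (tP 3%N).
  exact: Cc.
- exact: (tP 4%N).
- exact: (tP 2%N).
apply: (@wlim_unique _ _ _ U _ z_); first exact: wlim_sub oU zz.
have -> : z_ = fun n => bmul (a n) (y_ n) + c n by apply/funext.
by apply: wlimD => //; exact: wlim_bmul.
Qed.

End BanachAlgebra.

(** * The operator inclusion *)

Section Inclusion.
Context {R : realType} {E : banachAlgType R}.
Implicit Types (F A B C : E -> set E) (x y : E) (u v : nat -> E).

Lemma bounded_set_range u (M : R) : (forall n, `|u n| <= M) -> bounded_set (range u).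
Proof. by move=> uM; apply/bounded_setP; exists M => _ [n _ <-]. Qed.

Lemma bounded_set_mimage F (D W : set E) : W `<=` D ->
  bounded_set (mimage F D) -> bounded_set (mimage F W).
Proof.
move=> WD /bounded_setP[M FM]; apply/bounded_setP; exists M => y [x Wx Fxy].
by apply: FM; exists x => //; exact: WD.
Qed.

Lemma countable_range u : countable (range u).
Proof. exact: sub_countable (card_image_le _ _) (countableP _). Qed.

Lemma range_mimage F u v : (forall n, F (u n) (v n)) ->
  range v `<=` mimage F (range u).
Proof. by move=> Fuv _ [n _ <-]; exists (u n) => //; exists n. Qed.

Lemma set_contraction_seq F k u v (M : R) : set_contraction setT F k ->
  bounded_set (mimage F setT) -> (forall n, `|u n| <= M) ->
  (forall n, F (u n) (v n)) -> de_blasi (range v) <= k * de_blasi (range u).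
Proof.
move=> [_ Fk] bF uM Fuv; have bFu := bounded_set_mimage (@subsetT _ (range u)) bF.
apply: le_trans (de_blasi_sub (range_mimage Fuv) bFu) _.
by apply: Fk => //; exact: bounded_set_range uM.
Qed.

Lemma D_set_lipschitzian_seq F Phi u v (M : R) : D_set_lipschitzian setT F Phi ->
  bounded_set (mimage F setT) -> (forall n, `|u n| <= M) ->
  (forall n, F (u n) (v n)) -> de_blasi (range v) <= Phi (de_blasi (range u)).
Proof.
move=> [_ FPhi] bF uM Fuv; have bFu := bounded_set_mimage (@subsetT _ (range u)) bF.
apply: le_trans (de_blasi_sub (range_mimage Fuv) bFu) _.
by apply: FPhi => //; exact: bounded_set_range uM.
Qed.

Lemma countably_set_contraction_seq (D : set E) F k u v (M : R) :
  countably_set_contraction D F k ->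
  bounded_set (mimage F D) -> (forall n, D (u n)) -> (forall n, `|u n| <= M) ->
  (forall n, F (u n) (v n)) -> de_blasi (range v) <= k * de_blasi (range u).
Proof.
move=> [_ Fk] bF uD uM Fuv.
have uD' : range u `<=` D by move=> _ [n _ <-].
have bFu := bounded_set_mimage uD' bF.
apply: le_trans (de_blasi_sub (range_mimage Fuv) bFu) _.
by apply: Fk => //; [exact: countable_range|exact: bounded_set_range uM].
Qed.

Definition inclusion_map A C y x : set E := sum_set (prod_set (A x) [set y]) (C x).

Lemma inclusion_mapP A C y x z : inclusion_map A C y x z <->
  exists a c, [/\ A x a, C x c & z = bmul a y + c].
Proof.
split=> [[_ [a Aa [_ -> <-]] [c Cc <-]]|[a [c [Aa Cc ->]]]]; first by exists a, c.
by exists (bmul a y); [exists a => //; exists y|exists c].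
Qed.

Lemma inclusion_map_convex A C y x : convex (A x) -> convex (C x) ->
  convex (inclusion_map A C y x).
Proof.
move=> cA cC z z' t t01 /inclusion_mapP[a [c [Aa Cc ->]]] /inclusion_mapP[a' [c' [Aa' Cc' ->]]].
apply/inclusion_mapP; exists (t *: a + (1 - t) *: a'), (t *: c + (1 - t) *: c').
split; [exact: cA|exact: cC|].
by rewrite bmulDl !bmulZl !scalerDr addrACA.
Qed.

Section Hypotheses.
Variables (A C : E -> set E) (Phi : R -> R) (gamma MA MC : R).
Hypotheses (hP : condition_P E)
  (A_map : multimap setT A) (A_clcv : closed_convex_valued setT A)
  (C_map : multimap setT C) (C_clcv : closed_convex_valued setT C)
  (A_graph : weakly_seq_closed_graph setT A)
  (C_graph : weakly_seq_closed_graph setT C)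
  (hA : D_set_lipschitzian setT A Phi) (hC : set_contraction setT C gamma)
  (A_bounded : bounded_set (mimage A setT)) (C_bounded : bounded_set (mimage C setT))
  (AM : forall x a, A x a -> `|a| <= MA) (CM : forall x c, C x c -> `|c| <= MC).

Lemma inclusion_map_norm y x z : inclusion_map A C y x z -> `|z| <= MA * `|y| + MC.
Proof.
move=> /inclusion_mapP[a [c [Aa Cc ->]]]; apply: le_trans (ler_normD _ _) _.
apply: lerD; last exact: CM Cc.
by apply: le_trans (ler_norm_bmul _ _) _; apply: ler_wpM2r => //; exact: AM Aa.
Qed.

(** A weakly convergent sequence has measure zero, so [Phi 0 = 0] and the contraction property make
    the chosen values of [A] and [C] relatively weakly compact. *)
Lemma inclusion_map_graph (x_ y_ z_ u : nat -> E) (M : R) x z w :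
  relwcs y_ -> (forall n, `|x_ n| <= M) ->
  (forall n, inclusion_map A C (y_ n) (x_ n) (z_ n)) ->
  wlim \oo x_ x -> wlim \oo z_ z -> wlim \oo u w ->
  exists (t : nat -> nat) y, [/\ wlim \oo (u \o t) w, wlim \oo (y_ \o t) y &
    inclusion_map A C y x z].
Proof.
move=> yc xM xz xx zz uw.
have /choice[a aP] : forall n, exists a, exists c,
    [/\ A (x_ n) a, C (x_ n) c & z_ n = bmul a (y_ n) + c].
  by move=> n; apply/inclusion_mapP.
have /choice[c cP] := aP.
have x0 : de_blasi (range x_) = 0 by apply: relwcs_de_blasi0; exact: wlim_relwcs xx.
have aA n : A (x_ n) (a n) by have [] := cP n.
have cC n : C (x_ n) (c n) by have [] := cP n.
have ac : relwcs a.
  apply: (@de_blasi0_relwcs _ _ _ MA) => [n|]; first exact: AM (aA n).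
  have := D_set_lipschitzian_seq hA A_bounded xM aA.
  by have [_ _ _ Phi0] := hA.1; rewrite x0 Phi0.
have cc : relwcs c.
  apply: (@de_blasi0_relwcs _ _ _ MC) => [n|]; first exact: CM (cC n).
  by have := set_contraction_seq hC C_bounded xM cC; rewrite x0 mulr0.
have zE n : z_ n = bmul (a n) (y_ n) + c n by have [] := cP n.
have [t [a' [y [c' [Aa' Cc' ut yt zE']]]]] :=
  solution_graph hP A_graph C_graph ac cc yc aA cC zE xx zz uw.
by exists t, y; split=> //; apply/inclusion_mapP; exists a', c'.
Qed.

(** [Ma] bounds [A] only along [x_]: when these points lie in S it can be taken to be the norm of
    A(S). *)
Lemma inclusion_map_de_blasi (x_ y_ z_ : nat -> E) (M Ma Mb : R) :
  (forall n, `|x_ n| <= M) -> (forall n a, A (x_ n) a -> `|a| <= Ma) ->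
  (forall n, `|y_ n| <= Mb) ->
  (forall n, inclusion_map A C (y_ n) (x_ n) (z_ n)) ->
  de_blasi (range z_) <= Phi (de_blasi (range x_)) * Mb +
    2 * Ma * de_blasi (range y_) + gamma * de_blasi (range x_).
Proof.
move=> xM xMa yM xz.
have /choice[a aP] : forall n, exists a, exists c,
    [/\ A (x_ n) a, C (x_ n) c & z_ n = bmul a (y_ n) + c].
  by move=> n; apply/inclusion_mapP.
have /choice[c cP] := aP.
have aA n : A (x_ n) (a n) by have [] := cP n.
have cC n : C (x_ n) (c n) by have [] := cP n.
have aM n : `|a n| <= Ma := xMa n _ (aA n).
have cM n : `|c n| <= MC := CM (cC n).
have -> : z_ = fun n => bmul (a n) (y_ n) + c n.
  by apply/funext => n; have [] := cP n.
apply: le_trans (de_blasi_bmulD hP aM yM cM) _.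
have Mb0 : 0 <= Mb by apply: le_trans (yM 0%N).
apply: lerD; last exact: set_contraction_seq hC C_bounded xM cC.
rewrite lerD2r; apply: ler_wpM2r => //.
exact: D_set_lipschitzian_seq hA A_bounded xM aA.
Qed.

(** The domain is all of E, so that no invariance is required. A constant sequence [y] has measure
    zero, which removes the middle term of the product estimate. *)
Lemma inclusion_fixed_point y (Mb : R) : `|y| <= Mb ->
  (forall r, 0 < r -> Mb * Phi r + gamma * r < r) ->
  exists x, inclusion_map A C y x x.
Proof.
move=> yMb cond.
have [||||||| x _ xP] := @condensing_fixed_point R E setT (inclusion_map A C y) (MA * `|y| + MC).
- by exists 0.
- exact: closedT.
- by [].
- move=> x _; split=> //.
    have [a Aa] := A_map (x := x) I; have [c Cc] := C_map (x := x) I.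
    by exists (bmul a y + c); apply/inclusion_mapP; exists a, c.
  by apply: inclusion_map_convex; apply: convex_set_convex;
    [have [] := A_clcv (x := x) I|have [] := C_clcv (x := x) I].
- by move=> x z _; exact: inclusion_map_norm.
- move=> u v x z _ uM uv _ ux vz.
  have [t [y' [_ yt xz]]] := inclusion_map_graph (relwcs_cst y) uM uv ux vz ux.
  have <- // : y' = y := wlim_unique yt (@wlim_cst _ _ _ \oo _ y).
- move=> u v _ uM uv u0.
  have uMA n a : A (u n) a -> `|a| <= MA by exact: AM.
  have := inclusion_map_de_blasi uM uMA (fun=> yMb) uv.
  rewrite (relwcs_de_blasi0 (relwcs_cst y)) mulr0 addr0 mulrC => /le_lt_trans; apply.
  exact: cond.
by exists x.
Qed.

End Hypotheses.
End Inclusion.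

(* In the bound on delta the quotient is taken in the extended reals, where
   division by zero gives +oo, as 1 - gamma > 0: there is no upper bound on
   delta when A vanishes on S. *)
Theorem theorem4p3 (R : realType) (E : banachAlgType R)
    (hP : condition_P E)
    (S : set E) (S_neq0 : S !=set0) (S_closed : closed S)
    (S_convex : convex_set S)
    (A B C : E -> set E)
    (A_map : multimap setT A) (A_clcv : closed_convex_valued setT A)
    (C_map : multimap setT C) (C_clcv : closed_convex_valued setT C)
    (B_map : multimap S B)
    (A_graph : weakly_seq_closed_graph setT A)
    (B_graph : weakly_seq_closed_graph S B)
    (C_graph : weakly_seq_closed_graph setT C)
    (Phi : R -> R) (alpha gamma : R)
    (hA : D_set_lipschitzian setT A Phi)
    (hB : countably_set_contraction S B alpha)
    (hC : set_contraction setT C gamma)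
    (A_bounded : bounded_set (mimage A setT))
    (B_bounded : bounded_set (mimage B S))
    (C_bounded : bounded_set (mimage C setT))
    (hinv : forall u, S u ->
      [/\ closed (minverse (quot_IC A C) (B u)),
          convex_set (minverse (quot_IC A C) (B u)) &
          minverse (quot_IC A C) (B u) `<=` S])
    (hdelta : exists delta : R,
      [/\ 0 < delta,
          alpha < delta,
          (delta%:E < (1 - gamma)%:E / (norm_set (mimage A S))%:E)%E &
          forall r : R, 0 < r ->
            norm_set (mimage B S) * Phi r
              < (1 - 2 * delta * norm_set (mimage A S) - gamma) * r]) :
  exists x : E, S x /\ sum_set (prod_set (A x) (B x)) (C x) x.
Proof.
have [delta [delta0 ad _ dPhi]] := hdelta.
set MA := norm_set (mimage A S) in dPhi.
set MB := norm_set (mimage B S) in dPhi.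
have [MA' MA'P] := (bounded_setP _).1 A_bounded.
have [MC MCP] := (bounded_setP _).1 C_bounded.
have AM x a : A x a -> `|a| <= MA' by move=> Aa; apply: MA'P; exists x.
have CM x c : C x c -> `|c| <= MC by move=> Cc; apply: MCP; exists x.
have ASM x a : S x -> A x a -> `|a| <= MA.
  move=> Sx Aa; apply: norm_set_ge; last by exists x.
  exact: bounded_set_mimage A_bounded.
have BM x b : S x -> B x b -> `|b| <= MB.
  by move=> Sx Bb; apply: norm_set_ge => //; exists x.
have [s0 Ss0] := S_neq0.
have MA0 : 0 <= MA.
  by have [a Aa] := A_map s0 I; apply: le_trans (ASM _ _ Ss0 Aa).
have MB0 : 0 <= MB.
  by have [b Bb] := B_map _ Ss0; apply: le_trans (BM _ _ Ss0 Bb).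
have [alpha0 alpha1] : 0 <= alpha /\ alpha < 1 by have [/andP[]] := hB.
have [Phi_ge0 _ _ _] := hA.1.
pose H u := minverse (quot_IC A C) (B u).
have HP u x : H u x <-> exists2 y, B u y & inclusion_map A C y x x.
  by split=> [[y [xy Buy]]|[y Buy xy]]; exists y.
have HM u x : S u -> H u x -> `|x| <= MA' * MB + MC.
  move=> Su /HP[y Buy xy]; apply: le_trans (inclusion_map_norm AM CM xy) _.
  rewrite lerD2r; apply: ler_wpM2l; last exact: BM Su Buy.
  by have [a Aa] := A_map s0 I; apply: le_trans (AM _ _ Aa).
have HS u x : S u -> H u x -> S x by move=> Su; have [_ _] := hinv _ Su; apply.
have [|||||x Sx Hx] := @condensing_fixed_point R E S H (MA' * MB + MC) S_neq0 S_closed.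
- exact: convex_set_convex.
- move=> u Su; split; last by apply: convex_set_convex; have [] := hinv _ Su.
    have [y Buy] := B_map _ Su.
    have [r r0|x xP] := inclusion_fixed_point hP A_map A_clcv C_map C_clcv A_graph
      C_graph hA hC A_bounded C_bounded AM CM (BM _ _ Su Buy).
      have := dPhi r r0; have : 0 <= delta * MA * r.
        by rewrite !mulr_ge0 // ltW.
      rewrite !mulrBl mul1r; lra.
    by exists x; apply/HP; exists y.
  by move=> x; exact: HS.
- exact: HM.
- move=> u v x z Su uM uv Sx ux vz.
  have /choice[y yP] : forall n, exists y, B (u n) y /\ inclusion_map A C y (v n) (v n).
    by move=> n; have /HP[y] := uv n; exists y.
  have vM n : `|v n| <= MA' * MB + MC := HM _ _ (Su n) (uv n).
  have yM n : `|y n| <= MB := BM _ _ (Su n) (yP n).1.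
  (* [u] converges weakly, so its measure is zero, and the contraction property of [B] passes this
     on to [y]. *)
  have yc : relwcs y.
    apply: (de_blasi0_relwcs yM).
    have := countably_set_contraction_seq hB B_bounded Su uM (fun n => (yP n).1).
    by rewrite (relwcs_de_blasi0 (wlim_relwcs ux)) mulr0.
  have [t [y' [ut yt zz]]] := inclusion_map_graph hP A_graph C_graph hA hC A_bounded
    C_bounded AM CM yc vM (fun n => (yP n).2) vz vz ux.
  apply/HP; exists y' => //.
  apply: (B_graph (u \o t) (y \o t) x y') => //.
  + by move=> n; exact: Su.
  + exact/weak_cvg_wlim.
  + by move=> n; exact: (yP _).1.
  exact/weak_cvg_wlim.
- move=> u v Su uM uv u0.
  have /choice[y yP] : forall n, exists y, B (u n) y /\ inclusion_map A C y (v n) (v n).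
    by move=> n; have /HP[y] := uv n; exists y.
  have vM n : `|v n| <= MA' * MB + MC := HM _ _ (Su n) (uv n).
  have yM n : `|y n| <= MB := BM _ _ (Su n) (yP n).1.
  have vMA n a : A (v n) a -> `|a| <= MA by apply: ASM; exact: HS (Su n) (uv n).
  have := inclusion_map_de_blasi hP hA hC A_bounded C_bounded CM vM vMA yM
    (fun n => (yP n).2).
  have := countably_set_contraction_seq hB B_bounded Su uM (fun n => (yP n).1).
  move: (de_blasi_ge0 (range v)) u0; set b := de_blasi (range v).
  set w := de_blasi (range u); set q := de_blasi (range y) => b0 w0 qw bq.
  (* If [w <= b], then [q <= alpha * w <= delta * b], and the product estimate yields [b <= MB * Phi
     b + (2 * delta * MA + gamma) * b], contrary to the growth condition at [b]. *)
  rewrite ltNge; apply/negP => wb.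
  have {}b0 : 0 < b by exact: lt_le_trans wb.
  have := dPhi b b0.
  have qdb : q <= delta * b.
    apply: le_trans qw _; apply: ler_pM => //; [exact: ltW|exact: ltW].
  have : 2 * MA * q <= 2 * MA * (delta * b) by apply: ler_wpM2l; rewrite ?mulr_ge0.
  rewrite !mulrBl mul1r.
  have -> : 2 * MA * (delta * b) = 2 * delta * MA * b by ring.
  rewrite [MB * _]mulrC; lra.
have [y By /inclusion_mapP[a [c [Aa Cc xE]]]] := (HP _ _).1 Hx.
exists x; split=> //.
by exists (bmul a y); [exists a => //; exists y|exists c].
Qed.
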